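(* Let $N\ge2$, let $\mu_1<\cdots<\mu_K<0$ be the distinct spectral values with multiplicities $k_1,\dots,k_K\ge1$, $k_1+\cdots+k_K=N$. Let $U^{a,n}\in\mathcal{M}_{\mathrm{multi}}$, let $\mathcal{L}_{U^{a,n}}$ be the linearized operator at $U^{a,n}$, and let $T_{U^{a,n}}\mathcal{M}_{\mathrm{multi}}$ be the tangent space, all as defined in the context. Then $\dim\ker_{H^1(\mathbb{R})^N}\mathcal{L}_{U^{a,n}}=N$ and $$\ker_{H^1(\mathbb{R})^N}\mathcal{L}_{U^{a,n}}=T_{U^{a,n}}\mathcal{M}_{\mathrm{multi}}.$$
   Context: All functions are real-valued. Blocks and repeated parameters: $N_0:=0$, $N_\alpha:=k_1+\cdots+k_\alpha$, $I_\alpha:=\{N_{\alpha-1}+1,\dots,N_\alpha\}$ for $\alpha=1,\dots,K$, and $\nu_i:=\mu_\alpha$ for $i\in I_\alpha$. Put $\eta_\alpha=\sqrt{-\mu_\alpha}>0$. Reduced determinant family: for $a=(a_1,\dots,a_K)\in(\mathbb{R}\setminus\{0\})^K$ let $V^a=(V_1^a,\dots,V_K^a)$ with $$V_\alpha^a(x)=\frac{a_\alpha e^{\eta_\alpha x}\det(I+B^{(\alpha)}M(x))}{\det(I+M(x))},$$ where $I$ is the $K\times K$ identity matrix, $M(x)=(m_{\beta\gamma}(x))_{1\le\beta,\gamma\le K}$ with $m_{\beta\gamma}(x)=\frac{a_\beta a_\gamma}{2\sqrt{\eta_\beta\eta_\gamma}(\eta_\beta+\eta_\gamma)}e^{(\eta_\beta+\eta_\gamma)x}$,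 and $B^{(\alpha)}=\operatorname{diag}\big(\frac{\eta_\alpha-\eta_1}{\eta_\alpha+\eta_1},\dots,\frac{\eta_\alpha-\eta_K}{\eta_\alpha+\eta_K}\big)$. It solves $V_\alpha''+2(\sum_{\beta=1}^KV_\beta^2)V_\alpha+\mu_\alpha V_\alpha=0$, $\alpha=1,\dots,K$. Extended family: for $a\in(\mathbb{R}\setminus\{0\})^K$ and unit vectors $n^{(\alpha)}=(n^{(\alpha)}_i)_{i\in I_\alpha}\in\mathbb{S}^{k_\alpha-1}\subset\mathbb{R}^{k_\alpha}$, $\alpha=1,\dots,K$, define $U^{a,n}$ by $U_i^{a,n}(x)=n_i^{(\alpha)}V_\alpha^a(x)$ for $i\in I_\alpha$, $\alpha=1,\dots,K$; $\mathcal{M}_{\mathrm{multi}}$ is the set of all such $U^{a,n}$. Linearized operator: with $S^a=\sum_{\ell=1}^N(U_\ell^{a,n})^2=\sum_{\beta=1}^K(V_\beta^a)^2$, $$(\mathcal{L}_{U^{a,n}}\phi)_i:=-\phi_i''-\nu_i\phi_i-2S^a\phi_i-4U_i^{a,n}\sum_{\ell=1}^NU_\ell^{a,n}\phi_\ell\quad\text{in }\mathbb{R},\qquad i=1,\dots,N,$$ and $\ker_{H^1(\mathbb{R})^N}\mathcal{L}_{U^{a,n}}$ is the real vector space of all $\phi\in H^1(\mathbb{R})^N$ with $\mathcal{L}_{U^{a,n}}\phi=0$ (in the distributional sense). Tangent space: for $\gamma=1,\dots,K$ let $\Phi^{(\gamma)}$ have components $\Phi_i^{(\gamma)}=n_i^{(\alpha)}\partial_{a_\gamma}V_\alpha^a$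 for $i\in I_\alpha$, $\alpha=1,\dots,K$ (derivative of the family $a\mapsto V^a$ in the parameter $a_\gamma$). For $\alpha=1,\dots,K$ and $\xi=(\xi_i)_{i\in I_\alpha}\in\mathbb{R}^{k_\alpha}$ with $\xi\cdot n^{(\alpha)}=0$, let $\Psi^{(\alpha,\xi)}$ have components $\Psi_i^{(\alpha,\xi)}=\xi_iV_\alpha^a$ if $i\in I_\alpha$ and $\Psi_i^{(\alpha,\xi)}=0$ if $i\notin I_\alpha$. Then $$T_{U^{a,n}}\mathcal{M}_{\mathrm{multi}}:=\operatorname{span}\{\Phi^{(\gamma)},\Psi^{(\alpha,\xi)}:\ \gamma=1,\dots,K,\ \alpha=1,\dots,K,\ \xi\cdot n^{(\alpha)}=0\}.$$ *)

(* Defs.v *)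
From HB Require Import structures.
From mathcomp Require Import all_boot all_order all_algebra.
From mathcomp Require Import all_classical all_reals all_analysis.

Set Implicit Arguments.
Unset Strict Implicit.
Unset Printing Implicit Defensive.

Import Order.TTheory GRing.Theory Num.Theory.
Import numFieldNormedType.Exports.

Local Open Scope classical_set_scope.
Local Open Scope ring_scope.
Local Open Scope quotient_scope.

Definition lspan (R : realType) (V : lmodType R) (G : set V) : set V :=
  [set v | exists (d : nat) (c : 'I_d -> R) (g : 'I_d -> V),
     (forall j, G (g j)) /\ v = \sum_(j < d) c j *: g j].

Definition has_dim (R : realType) (V : lmodType R) (W : set V) (d : nat) : Prop :=
  exists b : 'I_d -> V,
    (forall c : 'I_d -> R, \sum_(j < d) c j *: b j = 0 -> forall j, c j = 0)
    /\ W = lspan (range b).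

Section AEFunctions.
Context (R : realType).
Local Notation mu := (@lebesgue_measure R).

(* R^o, which is R, only serves to make R -> R^o an R-module *)
Definition ae_null : {pred R -> R^o} :=
  [pred f | `[< {ae mu, forall x, f x = 0} >]].

Lemma ae_null_zmod_closed : zmod_closed ae_null.
Proof.
split; first by apply/asboolP/aeW.
move=> f g /asboolP f0 /asboolP g0; apply/asboolP.
by apply: filterS2 f0 g0 => x fx gx; rewrite !fctE fx gx subr0.
Qed.

HB.instance Definition _ := GRing.isZmodClosed.Build (R -> R^o) ae_null
  ae_null_zmod_closed.

Definition aefun : Type := Quotient.quot ae_null.
HB.instance Definition _ := GRing.Zmodule.on aefun.

Definition aeclass (f : R -> R) : aefun := \pi_(Quotient.quot ae_null) f.

Lemma aeclassP (f g : R -> R) : aeclass f = aeclass g <-> f = g %[ae mu].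
Proof.
have -> : (aeclass f = aeclass g) <-> (f : R -> R^o) - g \in ae_null.
  by rewrite Quotient.idealrBE; split=> [|/eqP //] e; apply/eqP.
have F := ae_filter_ringOfSetsType mu; split=> [/asboolP fg|fg].
  by apply: filterS fg => x /eqP; rewrite !fctE subr_eq0 => /eqP.
by apply/asboolP; apply: filterS fg => x /(_ I); rewrite !fctE => ->; rewrite subrr.
Qed.

Lemma aeclass_surj (u : aefun) : exists f, u = aeclass f.
Proof. by exists (repr (u : Quotient.quot ae_null)); rewrite /aeclass reprK. Qed.

Lemma aeclassD (f g : R -> R^o) : aeclass (f + g) = aeclass f + aeclass g.
Proof. exact: (raddfD (\pi_(Quotient.quot ae_null))). Qed.

Definition ae_scale (c : R) (u : aefun) : aefun :=
  aeclass (c *: (repr (u : Quotient.quot ae_null) : R -> R^o)).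

Lemma aeclassZ_subproof (c : R) (f : R -> R^o) :
  ae_scale c (aeclass f) = aeclass (c *: f).
Proof.
apply/aeclassP.
have /aeclassP : aeclass (repr (aeclass f : Quotient.quot ae_null)) = aeclass f.
  by rewrite /aeclass reprK.
have F := ae_filter_ringOfSetsType mu.
by move=> fg; apply: filterS fg => x e /e; rewrite !fctE => ->.
Qed.

Fact ae_scaleA a b u : ae_scale a (ae_scale b u) = ae_scale (a * b) u.
Proof.
by have [f ->] := aeclass_surj u; rewrite !aeclassZ_subproof scalerA.
Qed.

Fact ae_scale1 : left_id 1 ae_scale.
Proof.
by move=> u; have [f ->] := aeclass_surj u; rewrite aeclassZ_subproof scale1r.
Qed.

Fact ae_scaleDr : right_distributive ae_scale +%R.
Proof.
move=> a u v; have [f ->] := aeclass_surj u; have [g ->] := aeclass_surj v.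
by rewrite -aeclassD !aeclassZ_subproof scalerDr aeclassD.
Qed.

Fact ae_scaleDl u : {morph ae_scale^~ u : a b / a + b}.
Proof.
move=> a b; have [f ->] := aeclass_surj u.
by rewrite !aeclassZ_subproof scalerDl aeclassD.
Qed.

HB.instance Definition _ := GRing.Zmodule_isLmodule.Build R aefun
  ae_scaleA ae_scale1 ae_scaleDr ae_scaleDl.

Lemma aeclassZ (c : R) (f : R -> R^o) : aeclass (c *: f) = c *: aeclass f.
Proof. by rewrite -aeclassZ_subproof. Qed.

End AEFunctions.

Section Sobolev.
Context (R : realType).
Local Notation mu := (@lebesgue_measure R).

Definition test_function (psi : R -> R) : Prop :=
  (forall (n : nat) (x : R), derivable (derive1n n psi) x 1)
  /\ exists A : R, forall x, A < `|x| -> psi x = 0.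

Definition weak_derivative (f g : R -> R) : Prop :=
  forall psi, test_function psi ->
    \int[mu]_x (f x * derive1 psi x) = - \int[mu]_x (g x * psi x).

(* Membership in [Lfun] includes Borel measurability; every class of
   Lebesgue-measurable functions has a Borel representative. *)
Definition inH1 (f : R -> R) : Prop :=
  f \in Lfun mu 2%:E
  /\ exists2 g : R -> R, g \in Lfun mu 2%:E & weak_derivative f g.

End Sobolev.

Section Solitons.
Context (R : realType) (K : nat) (k : 'I_K -> nat) (mu_ : 'I_K -> R).
Local Notation mu := (@lebesgue_measure R).
Local Notation N := (\sum_(al < K) k al)%N.

(* [block i] is the index al of the interval I_al of consecutive indices
   containing i *)
Definition block (i : 'I_N) : 'I_K := tagnat.sig1 i.

Definition nu (i : 'I_N) : R := mu_ (block i).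

Definition eta (al : 'I_K) : R := Num.sqrt (- mu_ al).

Definition Mmx (a : 'I_K -> R) (x : R) : 'M[R]_K :=
  \matrix_(be, ga)
    (a be * a ga / (2 * Num.sqrt (eta be * eta ga) * (eta be + eta ga))
     * expR ((eta be + eta ga) * x)).

Definition Bmx (al : 'I_K) : 'M[R]_K :=
  diag_mx (\row_be ((eta al - eta be) / (eta al + eta be))).

Definition V (a : 'I_K -> R) (al : 'I_K) (x : R) : R :=
  a al * expR (eta al * x) * \det (1%:M + Bmx al *m Mmx a x)
  / \det (1%:M + Mmx a x).

Definition U (a : 'I_K -> R) (n : 'I_N -> R) (i : 'I_N) (x : R) : R :=
  n i * V a (block i) x.

(* n stacks the vectors n^(1), ..., n^(K), each of them a unit vector *)
Definition unit_blocks (n : 'I_N -> R) : Prop :=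
  forall al, \sum_(i < N | block i == al) n i ^+ 2 = 1.

(* The distribution (L_W phi)_i evaluated at the test function psi *)
Definition linearized (W phi : 'I_N -> R -> R) (i : 'I_N) (psi : R -> R) : R :=
  \int[mu]_x (- (phi i x * derive1n 2 psi x)
              + (- nu i * phi i x
                 - 2 * (\sum_(l < N) W l x ^+ 2) * phi i x
                 - 4 * W i x * \sum_(l < N) W l x * phi l x) * psi x).

(* Elements of H^1(R)^N are N-tuples of a.e. classes; the integrals above do
   not depend on the representative phi *)
Definition ker_linearized (W : 'I_N -> R -> R) : set ('I_N -> aefun R) :=
  [set u | exists phi : 'I_N -> R -> R,
     [/\ u = (fun i => aeclass (phi i)),
         forall i, inH1 (phi i) &
         forall i psi, test_function psi -> linearized W phi i psi = 0]].

Definition Phi (a : 'I_K -> R) (n : 'I_N -> R) (ga : 'I_K)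
    (i : 'I_N) (x : R) : R :=
  n i * derive1 (fun t : R => V [eta a with ga |-> t] (block i) x) (a ga).

(* Only the entries of xi in the block al matter *)
Definition Psi (a : 'I_K -> R) (al : 'I_K) (xi : 'I_N -> R)
    (i : 'I_N) (x : R) : R :=
  if block i == al then xi i * V a al x else 0.

Definition tangent (a : 'I_K -> R) (n : 'I_N -> R) : set ('I_N -> aefun R) :=
  lspan ([set u | exists ga, u = (fun i => aeclass (Phi a n ga i))]
         `|` [set u | exists al xi,
                \sum_(i < N | block i == al) xi i * n i = 0
                /\ u = (fun i => aeclass (Psi a al xi i))]).

End Solitons.

(* Main.v *)
(* With [h = eta], [v_b = a_b exp (h_b x) / sqrt (2 h_b)], [M = (v_b v_c / (h_b + h_c))],
   [H = diag h], the Lyapunov identity [H M + M H = v v^T] makes [1 + M] invertible.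
   Put [psi = (1 + M)^-1 v] and [Q = 2 (1 + M)^-1 - 1].  The matrix determinant lemma
   gives [V_al = sqrt (2 h_al) psi_al], and
     [Q H Q = H - 2 psi psi^T],   [Q' = - 2 psi psi^T],   [psi' = Q H psi],
     [a_g d/da_g psi = Q E_g psi]   with [E_g] the projection on the coordinate [g].
   All entries of [Q] and [psi] are therefore bounded, [psi] is square integrable
   since [2 psi_i ^ 2 = - Q_ii'], and both the equation of [V] and its linearization
   at the parameter derivatives follow by matrix algebra.

   The kernel of the linearized operator consists of the square integrable classical
   solutions of a system [p'' = A p] with [A] symmetric: a weak derivative is recovered
   at Lebesgue points by testing against smooth steps.  For two such solutions the
   Wronskian [p . r' - p' . r] is constant and integrable, hence zero.  Thus if [N]
   tangent vectors take independent values at one point [x0], any solution agrees at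
   [x0], up to the first derivative, with a combination of them, and everywhere by
   uniqueness.  Such an [x0] exists near [-oo], where [M] is small. *)

Require Import Defs.
From mathcomp Require Import all_boot all_order all_algebra.
From mathcomp Require Import all_classical all_reals all_analysis.
From mathcomp Require Import measurable_realfun ring lra.
Import Order.TTheory GRing.Theory Num.Theory.
Import numFieldNormedType.Exports.
Local Open Scope classical_set_scope.
Local Open Scope ring_scope.

Set Implicit Arguments.
Unset Strict Implicit.
Unset Printing Implicit Defensive.

(** * Algebra of the Cauchy matrix *)

(** Both the variable [x] and each single parameter move [v] with a velocity [L v], [L] diagonal, so
    one computation of the derivatives of [Q] and [psi] serves the flow and the tangent vectors
    alike. The linearized equation is checked by differentiating [Q E psi] twice in [x]; no mixed
    derivatives are exchanged. The upper bound on the kernel is the harder half, since the data of a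
    solution at a point fill a space of dimension [2 N]. No asymptotics of solutions are used: the
    Wronskian is a symplectic form on these data, and the square integrable solutions form an
    isotropic space, which [N] of them with independent values already exhaust. The point [x0] must
    be chosen with care: the values of the tangent vectors degenerate where some [psi_al] vanishes
    or [Q] is singular, and [(1 + M) Q = 1 - M] excludes the latter for small [M]. *)

Lemma mxDE (R : zmodType) m n (A B : 'M[R]_(m, n)) i j : (A + B) i j = A i j + B i j.
Proof. by rewrite mxE. Qed.

Lemma mxNE (R : zmodType) m n (A : 'M[R]_(m, n)) i j : (- A) i j = - A i j.
Proof. by rewrite mxE. Qed.

Lemma mxZE (R : pzRingType) m n a (A : 'M[R]_(m, n)) i j : (a *: A) i j = a * A i j.
Proof. by rewrite mxE. Qed.

Definition mxlinE := (mxDE, mxNE, mulmxnE).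

Section Cauchy.
Variables (R : realFieldType) (K : nat) (h : 'I_K -> R).
Hypothesis h_gt0 : forall b, 0 < h b.
Implicit Types (v : 'cV[R]_K) (l : 'I_K -> R).

Definition dmx l : 'M[R]_K := diag_mx (\row_b l b).
Definition cauchy v : 'M[R]_K := \matrix_(b, c) (v b 0 * v c 0 / (h b + h c)).
Definition Pmx v : 'M[R]_K := invmx (1%:M + cauchy v).
Definition psi v : 'cV[R]_K := Pmx v *m v.
Definition Qmx v : 'M[R]_K := Pmx v + Pmx v - 1%:M.

Lemma tr_dmx l : (dmx l)^T = dmx l.
Proof. exact: tr_diag_mx. Qed.

Lemma dmxE l i j : dmx l i j = l i *+ (i == j).
Proof. by rewrite !mxE; case: eqP => [->|]. Qed.

Lemma tr_cauchy v : (cauchy v)^T = cauchy v.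
Proof. by apply/matrixP => i j; rewrite !mxE mulrC (mulrC (v j 0)) (addrC (h j)) mulrC. Qed.

Lemma mul_dmxE l (m : nat) (A : 'M[R]_(K, m)) i j : (dmx l *m A) i j = l i * A i j.
Proof. by rewrite mul_diag_mx !mxE. Qed.

Lemma mul_mxdE l (m : nat) (A : 'M[R]_(m, K)) i j : (A *m dmx l) i j = A i j * l j.
Proof. by rewrite mul_mx_diag !mxE. Qed.

Lemma outerE (u w : 'cV[R]_K) i j : (u *m w^T) i j = u i 0 * w j 0.
Proof. by rewrite !mxE big_ord1 !mxE. Qed.

Lemma lyapunov v : dmx h *m cauchy v + cauchy v *m dmx h = v *m v^T.
Proof.
apply/matrixP => i j; rewrite mxE mul_dmxE mul_mxdE outerE !mxE.
by field; rewrite gt_eqF// addr_gt0.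
Qed.

(* If [y + M y = 0] then [0 <= (v . y) ^ 2 = y^T (H M + M H) y = - 2 y^T H y]. *)
Lemma unit_cauchy v : 1%:M + cauchy v \in unitmx.
Proof.
rewrite -row_free_unit -kermx_eq0; apply/rowV0P => y /sub_kermxP.
rewrite mulmxDr mulmx1 => /eqP; rewrite addr_eq0 => /eqP yM.
have My : cauchy v *m y^T = - y^T.
  by rewrite -{1}(tr_cauchy v) -trmx_mul {2}yM linearN /= opprK.
have : (y *m (dmx h *m cauchy v + cauchy v *m dmx h) *m y^T) 0 0 =
       (y *m (v *m v^T) *m y^T) 0 0 by rewrite lyapunov.
rewrite mulmxDr mulmxDl !mulmxA.
rewrite -(mulmxA _ _ y^T) My.
have -> : y *m cauchy v = - y by rewrite {2}yM opprK.
have -> : y *m v *m v^T *m y^T = (y *m v) *m (y *m v)^T by rewrite trmx_mul mulmxA.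
have s00 : forall z : 'rV[R]_K, (z *m dmx h *m y^T) 0 0 = \sum_i z 0 i * h i * y 0 i.
  by move=> z; rewrite mxE; apply: eq_bigr => i _; rewrite mul_mxdE mxE.
rewrite mulmxN [LHS]mxE [X in X + _]mxE !s00 [RHS]mxE big_ord1 [X in _ = _ * X]mxE.
set t := (y *m v) 0 0 => e.
have : \sum_i y 0 i * h i * y 0 i <= 0.
  have : \sum_i (- y) 0 i * h i * y 0 i = - \sum_i y 0 i * h i * y 0 i.
    by rewrite -sumrN; apply: eq_bigr => i _; rewrite mxE !mulNr.
  move=> e'; rewrite e' in e; nra.
rewrite le_eqVlt; have pos i : 0 <= y 0 i * h i * y 0 i.
  by rewrite mulrAC -expr2 mulr_ge0 ?sqr_ge0// ltW.
rewrite ltNge sumr_ge0 ?orbF// => /eqP /psumr_eq0P s0.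
apply/rowP => i; rewrite mxE; apply/eqP.
move: (s0 (fun i _ => pos i) i isT) => /eqP.
by rewrite !mulf_eq0 (gt_eqF (h_gt0 i)) orbF orbb.
Qed.

Lemma mulPmx v : Pmx v *m (1%:M + cauchy v) = 1%:M.
Proof. exact: mulVmx (unit_cauchy v). Qed.

Lemma mulmxP v : (1%:M + cauchy v) *m Pmx v = 1%:M.
Proof. exact: mulmxV (unit_cauchy v). Qed.

Lemma mulP_cauchy v : Pmx v *m cauchy v = 1%:M - Pmx v.
Proof. by rewrite -(mulPmx v) mulmxDr mulmx1 addrC addKr. Qed.

Lemma mulcauchy_P v : cauchy v *m Pmx v = 1%:M - Pmx v.
Proof. by rewrite -(mulmxP v) mulmxDl mul1mx addrC addKr. Qed.

Lemma tr_Pmx v : (Pmx v)^T = Pmx v.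
Proof. by rewrite trmx_inv linearD /= tr_cauchy trmx1. Qed.

Lemma tr_Qmx v : (Qmx v)^T = Qmx v.
Proof. by rewrite !linearD /= !tr_Pmx linearN /= trmx1. Qed.

(** The relations [P M = M P = 1 - P] remove the Cauchy matrix. The rate [l] stays free: [h] leads
    to the Riccati identity, a coordinate projection to the derivative in a parameter. *)
Lemma Pmx_lyapunov v l (L := dmx l) :
  Pmx v *m (L *m cauchy v + cauchy v *m L) *m Pmx v =
  Pmx v *m L + L *m Pmx v - (Pmx v *m L *m Pmx v + Pmx v *m L *m Pmx v).
Proof.
rewrite mulmxDr mulmxDl !mulmxA mulP_cauchy -(mulmxA _ (cauchy v)) mulcauchy_P.
rewrite !(mulNmx, mulmxN, mulmxBl, mulmxBr, mul1mx, mulmx1).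
by apply/matrixP => i j; rewrite !mxlinE; ring.
Qed.

Lemma Qmx_conj v l (L := dmx l) :
  Qmx v *m L *m Qmx v = L - (Pmx v *m (L *m cauchy v + cauchy v *m L) *m Pmx v) *+ 2.
Proof.
rewrite Pmx_lyapunov -/L /Qmx !(mulNmx, mulmxN, mulmxBl, mulmxBr, mulmxDl, mulmxDr, mul1mx, mulmx1, mulr2n).
by apply/matrixP => i j; rewrite !mxlinE; ring.
Qed.

Lemma Qmx_riccati v : Qmx v *m dmx h *m Qmx v = dmx h - (psi v *m (psi v)^T) *+ 2.
Proof.
by rewrite Qmx_conj lyapunov /psi trmx_mul tr_Pmx !mulmxA.
Qed.

Lemma psi_fix v : psi v = v - cauchy v *m psi v.
Proof.
by rewrite /psi mulmxA mulcauchy_P mulmxBl mul1mx opprB addrC subrK.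
Qed.

Lemma psiE v i : psi v i 0 = v i 0 * (1 - \sum_b v b 0 * psi v b 0 / (h i + h b)).
Proof.
rewrite {1}psi_fix !mxE mulrBr mulr1 mulr_sumr; congr (_ - _).
by apply: eq_bigr => b _; rewrite mxE; ring.
Qed.

(** A diagonal entry of the Riccati identity, with [Q] symmetric: nonnegative terms of total [h i],
    so each is bounded independently of [v]. *)
Lemma Qmx_riccatiE v i :
  \sum_b Qmx v i b ^+ 2 * h b + psi v i 0 ^+ 2 *+ 2 = h i.
Proof.
have /matrixP/(_ i i) := Qmx_riccati v.
rewrite mxE (eq_bigr (fun b => Qmx v i b ^+ 2 * h b)); last first.
  move=> b _; rewrite mul_mxdE -{2}(tr_Qmx v) [X in _ * X]mxE; ring.
by move=> ->; rewrite !mxlinE outerE dmxE eqxx mulr1n; ring.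
Qed.

Lemma psi_bound v i : psi v i 0 ^+ 2 <= h i.
Proof.
rewrite -[leRHS](Qmx_riccatiE v) mulr2n addrCA lerDl addr_ge0 ?sqr_ge0//.
by rewrite sumr_ge0// => b _; rewrite mulr_ge0 ?sqr_ge0// ltW.
Qed.

Lemma Qmx_bound v i j : Qmx v i j ^+ 2 <= h i / h j.
Proof.
rewrite ler_pdivlMr// -[leRHS](Qmx_riccatiE v) (bigD1 j)//= -addrA lerDl.
by rewrite addr_ge0 ?mulrn_wge0 ?sqr_ge0// sumr_ge0// => b _; rewrite mulr_ge0 ?sqr_ge0// ltW.
Qed.

(** Replacing [2 psi psi^T] by [H - Q H Q] makes the terms cubic in [Q] cancel. This is what moves
    [H^2] through [Q] in [tang_ode]. *)
Lemma Qmx_comm v :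
  Qmx v *m dmx h *m dmx h - dmx h *m dmx h *m Qmx v =
  (Qmx v *m dmx h *m (psi v *m (psi v)^T) - psi v *m (psi v)^T *m dmx h *m Qmx v) *+ 2.
Proof.
have : (psi v *m (psi v)^T) *+ 2 = dmx h - Qmx v *m dmx h *m Qmx v.
  by rewrite Qmx_riccati opprB addrC subrK.
move: (Qmx v) (dmx h) (psi v *m _) => Q H S e.
have -> : (Q *m H *m S - S *m H *m Q) *+ 2 = Q *m H *m (S *+ 2) - (S *+ 2) *m H *m Q.
  rewrite !mulr2n !(mulmxDl, mulmxDr).
  by apply/matrixP => i j; rewrite !mxlinE; ring.
rewrite e !(mulNmx, mulmxN, mulmxBl, mulmxBr, mulmxA).
by apply/matrixP => i j; rewrite !mxlinE; ring.
Qed.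

(** The block matrix [A] factors through either of its two Schur complements. *)
Lemma det_1Bouter (m : nat) (u w : 'cV[R]_m) :
  \det (1%:M - u *m w^T) = 1 - (w^T *m u) 0 0.
Proof.
pose A := block_mx (1%:M : 'M[R]_m) u w^T (1%:M : 'M[R]_1).
have e1 : A = block_mx 1%:M 0 w^T 1%:M *m block_mx 1%:M u 0 (1%:M - w^T *m u).
  by rewrite mulmx_block !(mul1mx, mulmx1, mul0mx, mulmx0, addr0) addrC subrK.
have e2 : A = block_mx 1%:M u 0 1%:M *m block_mx (1%:M - u *m w^T) 0 w^T 1%:M.
  by rewrite mulmx_block !(mul1mx, mulmx1, mul0mx, mulmx0, addr0, add0r) subrK.
have : \det A = \det A by [].
rewrite {1}e2 e1 !det_mulmx !det_lblock !det_ublock !det1 !mul1r mulr1 => ->.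
by rewrite det_mx11 !mxE eqxx.
Qed.

(** Conjugation by [D = h_al + H] keeps the determinant of [1 + B M] and produces
    [(1 + M) (1 - psi w^T)] with [w = D^-1 v], because [(h_i + h_j) M_ij = v_i v_j]. By [psiE],
    [v_al (1 - w . psi)] is [psi_al]. *)
Lemma det_psi v al :
  v al 0 * \det (1%:M + dmx (fun b => (h al - h b) / (h al + h b)) *m cauchy v)
    / \det (1%:M + cauchy v) = psi v al 0.
Proof.
have hne b : h al + h b != 0 by rewrite gt_eqF// addr_gt0.
pose D := dmx (fun b => h al + h b); pose D' := dmx (fun b => (h al + h b)^-1).
set B := dmx _.
have DD' : D *m D' = 1%:M.
  apply/matrixP => i j; rewrite mul_dmxE !mxE; case: eqP => [->|]; last by rewrite !mulr0n mulr0.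
  by rewrite !mulr1n mulfV.
have detD : \det D * \det D' = 1 by rewrite -det_mulmx DD' det1.
have e : D *m (1%:M + B *m cauchy v) *m D' = (1%:M + cauchy v) *m (1%:M - psi v *m (D' *m v)^T).
  rewrite mulmxBr mulmx1 mulmxA /psi [(1%:M + _) *m (_ *m v)]mulmxA mulmxP mul1mx.
  rewrite mulmxDr mulmxDl mulmx1 DD' -addrA; congr (_ + _).
  apply/matrixP => i j; rewrite mul_mxdE !mul_dmxE !mxlinE outerE mul_dmxE !mxE.
  by field; rewrite !hne gt_eqF ?addr_gt0.
have := congr1 determinant e; rewrite !det_mulmx mulrAC detD mul1r => ->.
rewrite mulrCA mulrC mulKf ?det_1Bouter; last by rewrite -unitfE -unitmxE unit_cauchy.
rewrite psiE; congr (_ * _); congr (_ - _).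
rewrite mxE; apply: eq_bigr => b _; rewrite mxE mul_dmxE; ring.
Qed.

End Cauchy.

(** * Entrywise derivatives of matrices *)

Section Derive.
Variable R : realType.
Implicit Types (f g : R -> R) (x : R).

Lemma is_deriveMf f g x df dg : is_derive x 1 f df -> is_derive x 1 g dg ->
  is_derive x 1 (fun t => f t * g t) (df * g x + f x * dg).
Proof.
move=> hf hg; have := is_deriveM hf hg.
by rewrite addrC [g x *: _]mulrC.
Qed.

Lemma is_deriveDf f g x df dg : is_derive x 1 f df -> is_derive x 1 g dg ->
  is_derive x 1 (fun t => f t + g t) (df + dg).
Proof. exact: is_deriveD. Qed.

Lemma is_deriveNf f x df : is_derive x 1 f df -> is_derive x 1 (fun t => - f t) (- df).
Proof. exact: is_deriveN. Qed.

Lemma is_deriveBf f g x df dg : is_derive x 1 f df -> is_derive x 1 g dg ->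
  is_derive x 1 (fun t => f t - g t) (df - dg).
Proof. exact: is_deriveB. Qed.

Lemma is_deriveZf f x c df : is_derive x 1 f df -> is_derive x 1 (fun t => c * f t) (c * df).
Proof. exact: is_deriveZ. Qed.

Lemma is_derive_sumf n (h : 'I_n -> R -> R) x (dh : 'I_n -> R) :
  (forall i, is_derive x 1 (h i) (dh i)) ->
  is_derive x 1 (fun t => \sum_(i < n) h i t) (\sum_(i < n) dh i).
Proof.
move=> hh; have := is_derive_sum hh; congr is_derive.
by apply/funext => t; rewrite fct_sumE.
Qed.

Lemma cvg_sumf (T : Type) (F : set_system T) (FF : Filter F) n (h : 'I_n -> T -> R)
    (l : 'I_n -> R) :
  (forall i, h i t @[t --> F] --> l i) ->
  \sum_(i < n) h i t @[t --> F] --> \sum_(i < n) l i.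
Proof. by move=> hl; apply: cvg_big => // z; exact: add_continuous. Qed.

Lemma is_derive_cvg f x df :
  (fun k : R => k^-1 * (f (k + x) - f x)) @ 0^' --> df <-> is_derive x 1 f df.
Proof.
have e : (fun k : R => k^-1 * (f (k + x) - f x)) =
         (fun k : R => k^-1 *: ((f \o shift x) (k *: 1) - f x)).
  by apply/funext => k /=; rewrite [k *: 1]mulr1.
rewrite e; split => [h|[h1 h2]].
  by apply: DeriveDef; [apply/cvg_ex; exists df|exact/cvg_lim].
by rewrite -h2; exact: h1.
Qed.

Lemma is_derive_continuous f x df : is_derive x 1 f df -> {for x, continuous f}.
Proof. by move=> [h _]; apply/differentiable_continuous/derivable1_diffP. Qed.

(** Entry by entry, so that rectangular products and transposes reduce to scalar rules without a
    norm on matrices. *)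
Definition mderiv m n (A : R -> 'M[R]_(m, n)) x (A' : 'M[R]_(m, n)) :=
  forall i j, is_derive x 1 (fun t => A t i j) (A' i j).

Lemma mderivM m n p (A : R -> 'M[R]_(m, n)) (B : R -> 'M[R]_(n, p)) x A' B' :
  mderiv A x A' -> mderiv B x B' ->
  mderiv (fun t => A t *m B t) x (A' *m B x + A x *m B').
Proof.
move=> hA hB i j; rewrite mxDE.
rewrite (_ : (fun t => _) = fun t => \sum_k A t i k * B t k j); last first.
  by apply/funext => t; rewrite mxE.
by rewrite !mxE -big_split; apply: is_derive_sumf => k; exact: is_deriveMf.
Qed.

Lemma mderivD m n (A B : R -> 'M[R]_(m, n)) x A' B' :
  mderiv A x A' -> mderiv B x B' -> mderiv (fun t => A t + B t) x (A' + B').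
Proof.
move=> hA hB i j; rewrite mxDE (_ : (fun t => _) = fun t => A t i j + B t i j).
  exact: is_deriveDf.
by apply/funext => t; rewrite mxDE.
Qed.

Lemma mderivZ m n (c : R) (A : R -> 'M[R]_(m, n)) x A' :
  mderiv A x A' -> mderiv (fun t => c *: A t) x (c *: A').
Proof.
move=> hA i j; rewrite mxE (_ : (fun t => _) = fun t => c * A t i j).
  exact: is_deriveZf.
by apply/funext => t; rewrite mxE.
Qed.

Lemma mderiv_cst m n (A : 'M[R]_(m, n)) x : mderiv (fun=> A) x 0.
Proof. by move=> i j; rewrite mxE; exact: is_derive_cst. Qed.

Lemma mderiv_tr m n (A : R -> 'M[R]_(m, n)) x A' :
  mderiv A x A' -> mderiv (fun t => (A t)^T) x A'^T.
Proof.
move=> hA i j; rewrite mxE (_ : (fun t => _) = fun t => A t j i) //.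
by apply/funext => t; rewrite mxE.
Qed.

(* [P s - P t = - P s (A s - A t) P t]: boundedness of [P] gives first its
   continuity, then its derivative. *)
Lemma mderiv_inv n (A P : R -> 'M[R]_n) x A' (C : R) :
  (forall t, P t *m A t = 1%:M) -> (forall t i j, `|P t i j| <= C) ->
  mderiv A x A' -> mderiv P x (- (P x *m A' *m P x)).
Proof.
move=> PA bP dA.
have AP t : A t *m P t = 1%:M by exact/mulmx1C.
have PB s : P s - P x = - (P s *m (A s - A x) *m P x).
  by rewrite mulmxBr mulmxBl PA mul1mx -mulmxA AP mulmx1 opprB.
have cA i j : {for x, continuous (fun t => A t i j)} by exact: is_derive_continuous (dA i j).
have eP i j s : P s i j = P x i j - \sum_k \sum_l P s i l * (A s l k - A x l k) * P x k j.
  have /matrixP/(_ i j) := PB s; rewrite !mxlinE => /eqP; rewrite subr_eq addrC => /eqP ->.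
  rewrite mxE; congr (_ - _); apply: eq_bigr => k _; rewrite mxE mulr_suml.
  by apply: eq_bigr => l _; rewrite !mxlinE.
have cP i j : {for x, continuous (fun t => P t i j)}.
  suff : (fun s => P x i j - \sum_k \sum_l P s i l * (A s l k - A x l k) * P x k j) @ x -->
      P x i j - 0.
    rewrite subr0; apply: cvg_trans; apply: near_eq_cvg; near=> s.
    by rewrite -eP.
  apply: cvgB; first exact: cvg_cst.
  have z : \sum_(k < n) (0 : R) = 0 by rewrite big1.
  rewrite -[X in _ --> X]z.
  apply: cvg_sumf => k.
  rewrite -[X in _ --> X]z.
  apply: cvg_sumf => l.
  rewrite -[X in _ --> X](mul0r (P x k j)); apply: cvgMl.
  have A0 : C * `|A t l k - A x l k| @[t --> x] --> C * `|A x l k - A x l k|.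
    by apply: cvgMr; apply: cvg_norm; apply: cvgB; [exact: cA|exact: cvg_cst].
  rewrite subrr normr0 mulr0 in A0.
  apply/cvgr0Pnorm_le.
  move=> e e0; apply: (filterS _ ((cvgr0Pnorm_le _).1 A0 e e0)) => t /= h.
  apply: le_trans h; rewrite !normrM normr_id ler_wpM2r//.
  by rewrite (le_trans (bP t i l))// ler_norm.
move=> i j; apply/is_derive_cvg.
rewrite (_ : (fun k => _) = fun k => - (\sum_a \sum_b P (k + x) i b *
   (k^-1 * (A (k + x) b a - A x b a)) * P x a j)); last first.
  apply/funext => s; rewrite [in LHS]eP addrAC subrr sub0r mulrN mulr_sumr; congr (- _).
  apply: eq_bigr => a _; rewrite mulr_sumr; apply: eq_bigr => b _; ring.
rewrite mxNE mxE; apply: cvgN; apply: cvg_sumf => a; rewrite mxE mulr_suml.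
apply: cvg_sumf => b; apply: cvgMl; apply: cvgM; last first.
  exact: (is_derive_cvg (fun t => A t b a) x _).2.
have : (fun k : R => k + x) @ 0^' --> x.
  rewrite -{2}(add0r x); apply: cvgD; last exact: cvg_cst.
  exact: nbhs_dnbhs.
by move=> h; exact: (cvg_comp _ _ h (cP i b)).
Unshelve. all: by end_near. Qed.
End Derive.

(** * The Riccati flow *)

Section Flow.
Variables (R : realType) (K : nat) (h : 'I_K -> R).
Hypothesis h_gt0 : forall b, 0 < h b.
Local Notation H := (dmx h).
Local Notation C := (cauchy h).
Local Notation P := (Pmx h).
Local Notation Q := (Qmx h).
Local Notation p := (psi h).

Lemma ler_norm_sqr (x : R) : `|x| <= x ^+ 2 + 1.
Proof. by case: (ler0P x) => _; nra. Qed.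

(** Dominates every [h i] and [h i / h j]; the final 1 pays for [ler_norm_sqr], which passes from a
    square to an absolute value without square roots. *)
Definition flow_bound : R := \sum_i h i + \sum_i \sum_j h i / h j + 1.

Lemma Qmx_le v i j : `|Q v i j| <= flow_bound.
Proof.
apply: (le_trans (ler_norm_sqr _)); rewrite lerD2r.
apply: (le_trans (Qmx_bound h_gt0 v i j)).
rewrite (bigD1 i)//= [X in _ <= _ + X](bigD1 i)//= [X in _ <= _ + (X + _)](bigD1 j)//=.
have s1 : 0 <= \sum_(j0 | j0 != i) h j0 by rewrite sumr_ge0// => b _; rewrite ltW.
have s2 : 0 <= \sum_(j0 | j0 != j) h i / h j0.
  by rewrite sumr_ge0// => b _; rewrite divr_ge0 ?ltW.
have s3 : 0 <= \sum_(j0 | j0 != i) \sum_c h j0 / h c.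
  by rewrite sumr_ge0// => b _; rewrite sumr_ge0// => c _; rewrite divr_ge0 ?ltW.
move: (ltW (h_gt0 i)) s1 s2 s3; set r := h i / h j; move: (\sum_(_ | _) _) (\sum_(_ | _) _) (\sum_(_ | _) _) => x y z; lra.
Qed.

Lemma psi_le v i : `|p v i 0| <= flow_bound.
Proof.
apply: (le_trans (ler_norm_sqr _)); rewrite lerD2r.
apply: (le_trans (psi_bound h_gt0 v i)).
rewrite (bigD1 i)//= -addrA lerDl addr_ge0//.
  by rewrite sumr_ge0// => b _; rewrite ltW.
by rewrite sumr_ge0// => b _; rewrite sumr_ge0// => c _; rewrite divr_ge0 ?ltW.
Qed.

Lemma Pmx_le v i j : `|P v i j| <= flow_bound + 1.
Proof.
have -> : P v i j = (Q v i j + (1%:M : 'M[R]_K) i j) / 2.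
  by rewrite /Qmx !mxlinE; field.
have : `|(1%:M : 'M[R]_K) i j| <= 1.
  by rewrite mxE; case: (i == j); rewrite ?mulr1n ?mulr0n ?normr1 ?normr0.
rewrite normrM [`|2^-1|]ger0_norm ?invr_ge0//.
have := Qmx_le v i j; have := ler_normD (Q v i j) ((1%:M : 'M[R]_K) i j).
have := normr_ge0 (Q v i j).
lra.
Qed.

Lemma mderiv_cauchy l (v : R -> 'cV[R]_K) x (L := dmx l) :
  mderiv v x (L *m v x) ->
  mderiv (fun t => C (v t)) x (L *m C (v x) + C (v x) *m L).
Proof.
move=> dv i j.
rewrite (_ : (fun t => _) = fun t => (h i + h j)^-1 * (v t i 0 * v t j 0)); last first.
  by apply/funext => t; rewrite mxE mulrC.
apply: is_derive_eq; first by apply: is_deriveZf; apply: is_deriveMf; exact: dv.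
by rewrite mxlinE mul_mxdE !mul_dmxE !mxE; ring.
Qed.

Lemma mderiv_Pmx l (v : R -> 'cV[R]_K) x (L := dmx l) :
  mderiv v x (L *m v x) ->
  mderiv (fun t => P (v t)) x
    (- (P (v x) *m (L *m C (v x) + C (v x) *m L) *m P (v x))).
Proof.
move=> dv; apply: (@mderiv_inv _ _ (fun t => 1%:M + C (v t)) _ _ _ (flow_bound + 1)).
- by move=> t; exact: mulPmx.
- by move=> t i j; exact: Pmx_le.
rewrite -[X in mderiv _ _ X]add0r; apply: mderivD; first exact: mderiv_cst.
exact: mderiv_cauchy.
Qed.

Lemma mderiv_Qmx l (v : R -> 'cV[R]_K) x (L := dmx l) :
  mderiv v x (L *m v x) ->
  mderiv (fun t => Q (v t)) x (Q (v x) *m L *m Q (v x) - L).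
Proof.
move=> dv; rewrite Qmx_conj// addrC addKr mulr2n opprD -[X in mderiv _ _ X]addr0.
apply: mderivD; last exact: mderiv_cst.
by apply: mderivD; exact: mderiv_Pmx.
Qed.

(** In [P' v + P L v] the terms [P L v] cancel by [Pmx_lyapunov], which leaves [(2 P - 1) L P v]. *)
Lemma mderiv_psi l (v : R -> 'cV[R]_K) x (L := dmx l) :
  mderiv v x (L *m v x) ->
  mderiv (fun t => p (v t)) x (Q (v x) *m L *m p (v x)).
Proof.
move=> dv; rewrite (_ : _ *m p _ = - (P (v x) *m (L *m C (v x) + C (v x) *m L) *m P (v x)) *m v x
   + P (v x) *m (L *m v x)); first by apply: mderivM => //; exact: mderiv_Pmx.
rewrite Pmx_lyapunov// -/L /psi /Qmx !(mulmxDl, mulmxBl, mulNmx, mul1mx, mulmxA).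
by apply/matrixP => i j; rewrite !mxlinE; ring.
Qed.

Section XFlow.
Variable v : R -> 'cV[R]_K.
Hypothesis dv : forall x, mderiv v x (H *m v x).
Local Notation q x := (p (v x)).

Lemma mderiv_Qmx_x x :
  mderiv (fun t => Q (v t)) x ((-2) *: (q x *m (q x)^T)).
Proof.
have := mderiv_Qmx (dv x); rewrite Qmx_riccati//.
by rewrite addrC addKr scaleNr scaler_nat.
Qed.

Lemma mderiv_psi_x x : mderiv (fun t => q t) x (Q (v x) *m H *m q x).
Proof. exact: mderiv_psi. Qed.

(** Each of the two terms of the product rule contributes [- 2 psi psi^T H psi], one from [Q'] and
    one from the Riccati identity. *)
Lemma psi_ode x :
  mderiv (fun t => Q (v t) *m H *m q t) x
    (H *m H *m q x - 4 *: (q x *m (q x)^T *m H *m q x)).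
Proof.
have D := mderivM (mderivM (@mderiv_Qmx_x x) (@mderiv_cst _ _ _ H x)) (@mderiv_psi_x x).
move: D; congr mderiv; rewrite mulmx0 addr0 !mulmxA Qmx_riccati//.
rewrite !(mulmxDl, mulNmx, mulr2n, mulmxA, =^~ scalemxAl).
by apply/matrixP => i j; rewrite !mxlinE !mxZE; ring.
Qed.

Variable e : 'I_K -> R.
Local Notation E := (dmx e).
(** By [mderiv_psi], the derivative of [psi] along the rate [e]; [tang'] is its derivative in [x]
    with [Q'] and [psi'] substituted. *)
Definition tang x := Q (v x) *m E *m q x.
Definition tang' x := (-2) *: (q x *m (q x)^T *m E *m q x)
  + Q (v x) *m E *m Q (v x) *m H *m q x.

Lemma mderiv_tang x : mderiv tang x (tang' x).
Proof.
have D := mderivM (mderivM (@mderiv_Qmx_x x) (@mderiv_cst _ _ _ E x)) (@mderiv_psi_x x).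
move: D; congr mderiv; rewrite mulmx0 addr0 /tang'.
by rewrite !(mulmxA, =^~ scalemxAl).
Qed.

(** Varying either factor of [psi^T H psi] gives the same scalar, hence the coefficient 8 beside the
    4 of [psi_ode]. *)
Lemma tang_ode x :
  mderiv tang' x (H *m H *m tang x - 4 *: (tang x *m (q x)^T *m H *m q x)
                  - 8 *: (q x *m (q x)^T *m H *m tang x)).
Proof.
have dp := @mderiv_psi_x x; have dQ := @mderiv_Qmx_x x.
have cE := @mderiv_cst _ _ _ E x; have cH := @mderiv_cst _ _ _ H x.
have D1 := mderivZ (-2) (mderivM (mderivM (mderivM dp (mderiv_tr dp)) cE) dp).
have D2 := mderivM (mderivM (mderivM (mderivM dQ cE) dQ) cH) dp.
move: (mderivD D1 D2); congr mderiv.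
have -> : (Q (v x) *m H *m q x)^T = (q x)^T *m H *m Q (v x).
  by move: (q x) => u; rewrite !trmx_mul tr_Qmx tr_dmx mulmxA.
rewrite !(mulmx0, addr0) /tang.
have commE : E *m H *m H = H *m H *m E.
  apply/matrixP => i j; rewrite !mul_mxdE !dmxE.
  by case: eqP => [->|_]; rewrite ?mulr1n ?mulr0n; ring.
have tr1 : (q x)^T *m E *m Q (v x) *m H *m q x = (q x)^T *m H *m Q (v x) *m E *m q x.
  have tr1x (Z : 'M[R]_1) : Z = Z^T by apply/matrixP => i j; rewrite mxE !ord1.
  by move: (q x) => u; rewrite [LHS]tr1x !trmx_mul trmxK tr_Qmx !tr_dmx !mulmxA.
have ric : Q (v x) *m H *m Q (v x) = H - (q x *m (q x)^T) *+ 2 by exact: Qmx_riccati.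
have com : Q (v x) *m H *m H *m E *m q x = H *m H *m Q (v x) *m E *m q x
    + ((Q (v x) *m H *m q x *m (q x)^T - q x *m (q x)^T *m H *m Q (v x)) *m E *m q x) *+ 2.
  have := Qmx_comm h_gt0 (v x); move: (q x) => u; rewrite !mulmxA => /eqP; rewrite subr_eq addrC => /eqP ->.
  by rewrite !mulr2n !mulmxDl !addrA.
(* The rest follows from four facts: [E] commutes with [H^2], a scalar equals its transpose, the
   Riccati identity, and [Qmx_comm]. The matrices are therefore generalized. *)
move: (q x) (Q (v x)) (H : 'M[R]_K) (E : 'M[R]_K) commE tr1 ric com.
move=> u U G F commE tr1 ric com.
have -> : U *m F *m U *m G *m (U *m G *m u) =
    U *m F *m (G - (u *m u^T) *+ 2) *m G *m u by rewrite -ric !mulmxA.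
have tr1' : u *m u^T *m F *m U *m G *m u = u *m u^T *m G *m U *m F *m u.
  by have := congr1 (mulmx u) tr1; rewrite !mulmxA.
have com' : U *m F *m G *m G *m u = U *m G *m G *m F *m u.
  by rewrite -!(mulmxA U) commE.
rewrite mulr2n !(mulmxDl, mulmxDr, mulmxBr, mulmxBl, mulmxN, mulNmx, mulmxA, =^~ scalemxAl, =^~ scalemxAr).
rewrite com' com !tr1' mulr2n !(mulmxBl, mulmxA).
by apply/matrixP => i j; rewrite !(mxlinE, mxZE); ring.
Qed.

End XFlow.
End Flow.

(** * Integrals on the line *)

Section Primitive.
Variable R : realType.
Local Notation mu := (@lebesgue_measure R).
Implicit Types (f g : R -> R) (a b c x : R).

Definition locint g := forall a b, mu.-integrable `[a, b] (EFin \o g).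

Lemma continuous_locint g : continuous g -> locint g.
Proof.
move=> cg a b; apply: continuous_compact_integrable; first exact: segment_compact.
exact: continuous_subspaceT.
Qed.

Lemma Rintegral_itv_ge g a b : b <= a -> \int[mu]_(t in `[a, b]) g t = 0.
Proof.
rewrite le_eqVlt => /predU1P[->|ba]; first by rewrite set_itv1 Rintegral_set1.
by rewrite set_itv_ge ?Rintegral_set0// bnd_simp -ltNge.
Qed.

Lemma Rintegral_itv_cat g a b c : locint g -> a <= b -> b <= c ->
  \int[mu]_(t in `[a, c]) g t = \int[mu]_(t in `[a, b]) g t + \int[mu]_(t in `[b, c]) g t.
Proof.
move=> ig ab bc; apply/eqP; rewrite addrC -subr_eq; apply/eqP.
rewrite Rintegral_itvB ?bnd_simp// Rintegral_itv_obnd_cbnd//.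
by apply: integrableS (ig b c) => //; apply: subset_itvr; rewrite bnd_simp.
Qed.

(** The oriented integral from 0: for each [x], at least one of the two integrals runs over an empty
    segment or a single point. *)
Definition prim g x := \int[mu]_(t in `[0, x]) g t - \int[mu]_(t in `[x, 0]) g t.

Lemma primB g a b : locint g -> a <= b ->
  prim g b - prim g a = \int[mu]_(t in `[a, b]) g t.
Proof.
move=> ig ab; rewrite /prim; have [a0|a0] := leP 0 a.
  rewrite !(@Rintegral_itv_ge g _ 0)// ?(le_trans a0)// !subr0.
  by rewrite (Rintegral_itv_cat ig a0 ab) addrC addKr.
rewrite (@Rintegral_itv_ge g 0 a) ?(ltW a0)//; have [b0|b0] := leP 0 b.
  by rewrite (@Rintegral_itv_ge g b)// (Rintegral_itv_cat ig (ltW a0) b0); ring.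
by rewrite (@Rintegral_itv_ge g 0 b) ?(Rintegral_itv_cat ig ab (ltW b0)) ?ltW//; ring.
Qed.

Lemma prim_shift g c x : locint g -> c <= x ->
  prim g x = prim g c + \int[mu]_(t in `[c, x]) g t.
Proof. by move=> ig cx; rewrite -primB// addrC subrK. Qed.

Lemma continuous_prim g : locint g -> continuous (prim g).
Proof.
move=> ig x; pose c := x - 1; pose d := x + 1.
have [cx xd] : c < x /\ x < d by rewrite /c /d; split; lra.
have cd : c < d by exact: lt_trans xd.
have h : {for x, continuous (fun y => \int[mu]_(t in `[c, y]) g t)}.
  apply: (within_continuous_continuous cd); last by rewrite in_itv/= cx.
  exact: parameterized_integral_continuous (ltW cd) (ig c d).
have h2 : prim g c + \int[mu]_(t in `[c, y]) g t @[y --> x] --> prim g x.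
  rewrite [X in _ --> X](prim_shift ig (ltW cx)).
  by apply: cvgD => //; exact: cvg_cst.
apply: cvg_trans h2; apply: near_eq_cvg; near=> y.
rewrite -(prim_shift ig)//; apply: ltW.
by near: y; exact: lt_nbhsr.
Unshelve. all: by end_near. Qed.

Lemma is_derive_prim g x : locint g -> {for x, continuous g} -> is_derive x 1 (prim g) (g x).
Proof.
move=> ig cg; pose c := x - 1; pose d := x + 1.
have [xd cx] : x < d /\ c < x by rewrite /c /d; split; lra.
have [D1 D2] := continuous_FTC1_closed xd (ig c d) cx cg.
have h : is_derive x 1 (fun y => prim g c + \int[mu]_(t in `[c, y]) g t) (g x).
  rewrite -D2 derive1E; have := is_deriveDf (is_derive_cst (prim g c : R) x 1) (derivableP D1).
  by rewrite add0r.
apply: near_eq_is_derive h; near=> y.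
rewrite -(prim_shift ig)//; apply: ltW.
by near: y; exact: lt_nbhsr.
Unshelve. all: by end_near. Qed.

End Primitive.

(** * Smooth test functions *)

Section Bump.
Variable R : realType.
Implicit Types (p : {poly R}) (m : nat) (x y : R).

Definition bpoly : {poly R} := 'X * (1 - 'X).

Definition bump_in p m x := p.[x] / bpoly.[x] ^+ m * expR (- bpoly.[x]^-1).

(* Every derivative of [bump 1 0] is again of this form, by [is_derive_bump]. *)
Definition bump p m x : R := if 0 < x < 1 then bump_in p m x else 0.

(** Numerator of the derivative of [bump_in p m] over the denominator [bpoly ^+ m.+2]. *)
Definition dbump p m : {poly R} :=
  p^`() * bpoly ^+ 2 - p * bpoly^`() * bpoly *+ m + p * bpoly^`().

Lemma bpolyE x : bpoly.[x] = x * (1 - x).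
Proof. by rewrite !hornerE. Qed.

Lemma is_derive_bump_in p m x : bpoly.[x] != 0 ->
  is_derive x 1 (bump_in p m) (bump_in (dbump p m) m.+2 x).
Proof.
move=> s0.
have ds : is_derive x 1 (horner bpoly) bpoly^`().[x] by exact: is_derive_poly.
have di : is_derive x 1 (fun y => bpoly.[y]^-1) (- bpoly.[x] ^- 2 * bpoly^`().[x]).
  exact: is_deriveV.
have de : is_derive x 1 (fun y => expR (- bpoly.[y]^-1))
    (expR (- bpoly.[x]^-1) * (bpoly.[x] ^- 2 * bpoly^`().[x])).
  have := @is_derive1_comp _ expR (fun y => - bpoly.[y]^-1) x _ _ (is_derive_expR _) (is_deriveNf di).
  by rewrite mulNr opprK.
have dm : is_derive x 1 (fun y => bpoly.[y]^-1 ^+ m)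
    (m%:R * bpoly.[x]^-1 ^+ m.-1 * (- bpoly.[x] ^- 2 * bpoly^`().[x])).
  have := is_deriveX m di; congr is_derive.
  by apply/funext => y; rewrite fctE.
have := is_deriveMf (is_deriveMf (is_derive_poly p x) dm) de.
have -> : (fun t => p.[t] * bpoly.[t]^-1 ^+ m * expR (- bpoly.[t]^-1)) = bump_in p m.
  by apply/funext => t; rewrite /bump_in exprVn.
move=> D; apply: (is_derive_eq D).
clear D dm de di ds; rewrite /bump_in /dbump.
move: (bpoly) s0 (expR _) => s s0 e.
rewrite !(hornerD, hornerN, hornerM, hornerMn, horner_exp).
move: s.[x] s0 s^`().[x] p.[x] p^`().[x] => S s0 S' P P'; case: m => [|m].
  by rewrite /= !expr0 mulr0n; field.
rewrite -mulr_natr /= !exprVn !exprS; move: (S ^+ m) (expf_neq0 m s0) => Sm Sm0.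
by field; rewrite s0 Sm0.
Qed.

(** With [y = 1 / x] this is [y ^ m <= m! exp y], a single term of the exponential series. *)
Lemma exprV_expR_le m x : 0 < x -> x ^- m * expR (- x^-1) <= m`!%:R.
Proof.
move=> x0; case: m => [|m].
  by rewrite expr0 invr1 mul1r fact0 -expR0 ler_expR oppr_le0 invr_ge0 ltW.
rewrite expRN ler_pdivrMr ?expR_gt0// mulrC -ler_pdivrMr ?ltr0n ?fact_gt0//.
have xi : 0 <= x^-1 by rewrite invr_ge0 ltW.
by have := expR_ge1Dxn m xi; rewrite exprVn; lra.
Qed.

Lemma horner_bound p x : 0 < x < 1 -> `|p.[x]| <= \sum_(i < size p) `|p`_i|.
Proof.
move=> /andP[x0 x1]; rewrite horner_coef (le_trans (ler_norm_sum _ _ _))// ler_sum// => i _.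
by rewrite normrM ler_piMr// ger0_norm ?exprn_ge0 ?exprn_ile1 ?ltW.
Qed.

(* Quadratic decay at the end points makes the extension by 0 differentiable. *)
Lemma bump_sqr p m : exists C, forall x y, ~~ (0 < x < 1) -> `|bump p m y| <= C * (y - x) ^+ 2.
Proof.
exists ((\sum_(i < size p) `|p`_i|) * m.+2`!%:R) => x y xn.
set c := \sum_(i < _) _; have c0 : 0 <= c by rewrite sumr_ge0.
rewrite /bump; case: ifP => [y01|_]; last first.
  by rewrite normr0 mulr_ge0 ?sqr_ge0 ?mulr_ge0.
have b0 : 0 < bpoly.[y] by rewrite bpolyE; case/andP: y01 => *; rewrite mulr_gt0 ?subr_gt0.
(* Two factors [bpoly.[y]] are split off for the quadratic decay; the negative power left is [m.+2],
   whence the factorial in the constant. *)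
have -> : bump_in p m y = p.[y] * (bpoly.[y] ^- m.+2 * expR (- bpoly.[y]^-1)) * bpoly.[y] ^+ 2.
  rewrite /bump_in; move: (expR _) => e; have := lt0r_neq0 b0.
  move: bpoly.[y] p.[y] => S P S0; rewrite !exprS.
  by move: (S ^+ m) (expf_neq0 m S0) => Sm Sm0; field; rewrite S0 Sm0.
rewrite normrM normrM; apply: ler_pM => //.
- apply: ler_pM => //; first exact: horner_bound.
  rewrite ger0_norm ?exprV_expR_le// mulr_ge0 ?expR_ge0// invr_ge0 exprn_ge0//.
  exact: ltW.
(* For [y] in the unit interval, [y (1 - y)] is at most the distance from [y] to any point
   outside. *)
- rewrite ger0_norm ?sqr_ge0// bpolyE.
  have [x0|x1] : x <= 0 \/ 1 <= x.
    by move: xn; rewrite negb_and -!leNgt => /orP.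
  + case/andP: y01 => y0 y1; have : 0 <= y * (1 - y) <= y - x by apply/andP; split; nra.
    by case/andP => *; rewrite ler_pXn2r// nnegrE; lra.
  + case/andP: y01 => y0 y1; have : 0 <= y * (1 - y) <= x - y by apply/andP; split; nra.
    by case/andP => *; rewrite -[leRHS]sqrrN opprB ler_pXn2r// nnegrE; lra.
Qed.

Lemma is_derive_sqr_bound (f : R -> R) x C : f x = 0 ->
  (forall y, `|f y| <= C * (y - x) ^+ 2) -> is_derive x 1 f 0.
Proof.
move=> fx fC; apply/is_derive_cvg; rewrite fx; apply/cvgr0Pnorm_le => e e0.
have C0 : 0 <= C by have := fC (x + 1); have := normr_ge0 (f (x + 1)); rewrite [_ + 1]addrC addrK expr1n mulr1 => h1; exact: le_trans.
(* [C] may be 0, so the division below is by [C + 1]. *)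
have C1 : 0 < C + 1 by lra.
near=> k; have k0 : k != 0 by near: k; exact: nbhs_dnbhs_neq.
have kp : 0 < `|k| by rewrite normr_gt0.
rewrite subr0 normrM normfV ler_pdivrMl//.
apply: (le_trans (fC _)); rewrite addrK -[k ^+ 2]real_normK ?num_real//.
have : C * `|k| <= e.
  have : `|k| <= e / (C + 1).
    near: k; exact: (dnbhs0_le (divr_gt0 e0 C1)).
  by rewrite ler_pdivlMr//; nra.
by move=> h; rewrite expr2 mulrA [leRHS]mulrC ler_wpM2r.
Unshelve. all: by end_near. Qed.

Lemma is_derive_bump p m x : is_derive x 1 (bump p m) (bump (dbump p m) m.+2 x).
Proof.
have [x01|xn] := boolP (0 < x < 1).
  have := x01; case/andP => x0 x1; have b0 : bpoly.[x] != 0.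
    by rewrite bpolyE mulf_neq0 ?gt_eqF// subr_gt0.
  rewrite {2}/bump x01; apply: near_eq_is_derive (is_derive_bump_in p m b0).
  near=> y; rewrite /bump ifT//; apply/andP; split; near: y; [exact: lt_nbhsr|exact: lt_nbhsl].
have [C hC] := bump_sqr p m.
rewrite {2}/bump (negbTE xn); apply: (is_derive_sqr_bound (C := C)).
  by rewrite /bump (negbTE xn).
by move=> y; exact: hC.
Unshelve. all: by end_near. Qed.

End Bump.

(** * Square integrable functions *)

Section L2.
Variable R : realType.
Local Notation mu := (@lebesgue_measure R).
Implicit Types (f g k : R -> R).

Definition L2 f := measurable_fun setT f /\ mu.-integrable setT (EFin \o (fun x => f x ^+ 2)).

Lemma Lfun2P f : f \in Lfun mu 2%:E <-> L2 f.
Proof.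
split=> [h|[mf h]].
  split; last exact: Lfun2_integrable_sqr.
  by move: h => /sub_Lfun_mfun; rewrite inE.
rewrite inE; apply/andP; split; rewrite inE//=.
rewrite /finite_norm unlock poweR_lty//.
move/integrableP : h => [_]; apply: le_lt_trans.
rewrite le_eqVlt; apply/orP; left; apply/eqP; apply: eq_integral => x _ /=.
by rewrite powR_mulrn// normrX.
Qed.

Lemma integrable_le D f g : measurable D -> measurable_fun D f ->
  (forall x, D x -> `|f x| <= g x) ->
  mu.-integrable D (EFin \o g) -> mu.-integrable D (EFin \o f).
Proof.
move=> mD mf fg; apply: le_integrable => //; first exact/measurable_EFinP.
by move=> x Dx /=; rewrite lee_fin (le_trans (fg _ Dx))// ler_norm.
Qed.

Lemma integrableMb D f k C : measurable D -> mu.-integrable D (EFin \o f) ->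
  measurable_fun D k -> (forall x, `|k x| <= C) ->
  mu.-integrable D (EFin \o (fun x => f x * k x)).
Proof.
move=> mD If mk kC.
have mf : measurable_fun D f by apply/measurable_EFinP; exact: measurable_int If.
apply: (@integrable_le _ _ (fun x => C * `|f x|)) => //.
- exact: measurable_funM.
- by move=> x _; rewrite normrM mulrC ler_wpM2r.
- have := integrableZl mD C (integrable_norm If).
  by apply: eq_integrable => // x _ /=.
Qed.

Lemma integrableDf D f g : measurable D -> mu.-integrable D (EFin \o f) ->
  mu.-integrable D (EFin \o g) -> mu.-integrable D (EFin \o (fun x => f x + g x)).
Proof. by move=> mD If Ig; apply: eq_integrable (integrableD mD If Ig). Qed.

Lemma integrableBf D f g : measurable D -> mu.-integrable D (EFin \o f) ->
  mu.-integrable D (EFin \o g) -> mu.-integrable D (EFin \o (fun x => f x - g x)).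
Proof. by move=> mD If Ig; apply: eq_integrable (integrableB mD If Ig). Qed.

Lemma integrableZf D f c : measurable D -> mu.-integrable D (EFin \o f) ->
  mu.-integrable D (EFin \o (fun x => c * f x)).
Proof. by move=> mD If; apply: eq_integrable (integrableZl mD c If). Qed.

Lemma integrable_sumf D n (F : 'I_n -> R -> R) : measurable D ->
  (forall i, mu.-integrable D (EFin \o F i)) ->
  mu.-integrable D (EFin \o (fun x => \sum_(i < n) F i x)).
Proof.
move=> mD IF; have := @integrable_sum _ _ _ mu D mD _ (index_enum 'I_n) xpredT (fun i => EFin \o F i) (fun i _ => IF i).
by apply: eq_integrable => // x _ /=; rewrite sumEFin.
Qed.

Lemma L2_mul f g : L2 f -> L2 g -> mu.-integrable setT (EFin \o (fun x => f x * g x)).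
Proof.
move=> [mf If] [mg Ig]; apply: (@integrable_le _ _ (fun x => f x ^+ 2 + g x ^+ 2)) => //.
- exact: measurable_funM.
- move=> x _; rewrite ler_norml; apply/andP; split; nra.
- exact: integrableDf.
Qed.

Lemma L2D f g : L2 f -> L2 g -> L2 (fun x => f x + g x).
Proof.
move=> [mf If] [mg Ig]; split; first exact: measurable_funD.
apply: (@integrable_le _ _ (fun x => 2 * (f x ^+ 2 + g x ^+ 2))) => //.
- by apply: measurable_funX; exact: measurable_funD.
- move=> x _; rewrite ger0_norm ?sqr_ge0//; have := sqr_ge0 (f x - g x); nra.
- by apply: integrableZf => //; exact: integrableDf.
Qed.

Lemma L2_mulb f k C : L2 f -> measurable_fun setT k -> (forall x, `|k x| <= C) ->
  L2 (fun x => f x * k x).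
Proof.
move=> [mf If] mk kC; split; first exact: measurable_funM.
apply: (@integrable_le _ _ (fun x => C ^+ 2 * f x ^+ 2)) => //.
- by apply: measurable_funX; exact: measurable_funM.
- move=> x _; rewrite ger0_norm ?sqr_ge0// exprMn mulrC ler_wpM2r ?sqr_ge0//.
  by rewrite -(real_normK (num_real (k x))) ler_pXn2r// nnegrE// (le_trans _ (kC x)).
- exact: integrableZf.
Qed.

Lemma L2_0 : L2 (fun=> 0).
Proof.
split; first exact: measurable_cst.
by apply: eq_integrable (integrable0 mu setT) => // x _ /=; rewrite expr0n.
Qed.

Lemma L2Z f c : L2 f -> L2 (fun x => c * f x).
Proof.
move=> lf; have := @L2_mulb f (fun=> c) `|c| lf (measurable_cst _) (fun _ => lexx _).
by congr L2; apply/funext => x; rewrite mulrC.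
Qed.

Lemma L2_sum n (F : 'I_n -> R -> R) : (forall i, L2 (F i)) -> L2 (fun x => \sum_(i < n) F i x).
Proof.
elim: n F => [|n IH] F lF.
  rewrite (_ : (fun _ => _) = fun=> 0); first exact: L2_0.
  by apply/funext => x; rewrite big_ord0.
rewrite (_ : (fun _ => _) = fun x => F ord0 x + \sum_(i < n) F (lift ord0 i) x).
  by apply: L2D => //; apply: IH.
by apply/funext => x; rewrite big_ord_recl.
Qed.

Lemma L2_ae f g : L2 f -> measurable_fun setT g -> {ae mu, forall x, f x = g x} -> L2 g.
Proof.
move=> [mf /integrableP[mf2 If]] mg fg; split => //.
have mg2 : measurable_fun setT (EFin \o (fun x => g x ^+ 2)).
  by apply/measurable_EFinP; exact: measurable_funX.
apply/integrableP; split => //; apply: le_lt_trans If.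
rewrite le_eqVlt; apply/orP; left; apply/eqP; apply: ae_eq_integral => //.
- exact: measurableT_comp.
- exact: measurableT_comp.
- have F := ae_filter_ringOfSetsType mu.
  by apply: filterS fg => x e _ /=; rewrite e.
Qed.

Lemma ae_Rintegral D f g : measurable D -> measurable_fun setT f -> measurable_fun setT g ->
  {ae mu, forall x, f x = g x} -> \int[mu]_(x in D) f x = \int[mu]_(x in D) g x.
Proof.
move=> mD mf mg fg; congr fine; apply: ae_eq_integral => //.
- by apply/measurable_EFinP; exact: measurable_funS mf.
- by apply/measurable_EFinP; exact: measurable_funS mg.
- have F := ae_filter_ringOfSetsType mu.
  by apply: filterS fg => x e _; rewrite e.
Qed.

Lemma L2_locint f : L2 f -> locint f.
Proof.
move=> [mf If] a b; apply: (@integrable_le _ _ (fun x => f x ^+ 2 + 1)) => //.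
- exact: measurable_funS mf.
- move=> x _; case: (ler0P (f x)) => _; nra.
- apply: integrableDf => //; first exact: integrableS If.
  apply: (@continuous_locint _ (fun=> 1)); exact: cst_continuous.
Qed.

End L2.

(** * Derivatives, integrals and almost everywhere equality *)

Section Integrals.
Variable R : realType.
Local Notation mu := (@lebesgue_measure R).
Implicit Types (f g k F : R -> R) (a b c x C : R).

Lemma continuous_is_derive f g : (forall x, is_derive x 1 f (g x)) -> continuous f.
Proof. by move=> fg x; exact: is_derive_continuous (fg x). Qed.

Lemma derive1_is_derive f g : (forall x, is_derive x 1 f (g x)) -> derive1 f = g.
Proof. by move=> fg; apply/funext => x; rewrite derive1E; have [_ ->] := fg x. Qed.

Lemma Rintegral_FTC2 F f a b : a <= b -> continuous f ->
  (forall x, is_derive x 1 F (f x)) -> \int[mu]_(x in `[a, b]) f x = F b - F a.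
Proof.
move=> ab cf dF; rewrite -primB//; last exact: continuous_locint.
have d0 x : is_derive x 1 (fun t => prim f t - F t) 0.
  have := is_deriveBf (is_derive_prim (continuous_locint cf) (cf x)) (dF x).
  by rewrite subrr.
have := is_derive_0_is_cst b a d0; lra.
Qed.

Lemma Rintegral_supp h a b : (forall x, ~~ (a <= x <= b) -> h x = 0) ->
  \int[mu]_x h x = \int[mu]_(x in `[a, b]) h x.
Proof.
move=> h0; rewrite [RHS]Rintegral_mkcond; apply: eq_Rintegral => x _.
rewrite patchE; case: ifPn => // xab; apply: h0; apply: contraNN xab => xab.
by rewrite inE/= in_itv.
Qed.

Lemma Rintegral_derive_supp F f a b : continuous f ->
  (forall x, is_derive x 1 F (f x)) ->
  (forall x, ~~ (a < x < b) -> F x = 0) -> \int[mu]_x f x = 0.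
Proof.
(* The maximum ensures [c < d] even if [b] lies below [a]. *)
move=> cf dF F0; pose c := a - 1; pose d := Num.max b c + 1.
have [ca [bd cd]] : c < a /\ b < d /\ c < d.
  rewrite /d /c; split; [by lra|split].
    by rewrite ltr_pwDr// le_max lexx.
  by rewrite ltr_pwDr// le_max lexx orbT.
rewrite (@Rintegral_supp _ c d).
  rewrite (Rintegral_FTC2 (ltW cd) cf dF) !F0 ?subrr//.
    by rewrite negb_and -!leNgt (ltW ca).
  by rewrite negb_and -!leNgt (ltW bd) orbT.
(* Outside [[c, d]] the function [F] vanishes on a neighbourhood, so its derivative [f x] is 0. *)
move=> x xn; have F0x : \forall y \near x, 0 = F y.
  move: xn; rewrite negb_and -!ltNge => /orP[xc|dx].
    near=> y; rewrite F0// negb_and -!leNgt; apply/orP; left; apply: ltW.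
    by near: y; apply: lt_nbhsl; exact: lt_trans ca.
  near=> y; rewrite F0// negb_and -!leNgt; apply/orP; right; apply: ltW.
  by near: y; apply: lt_nbhsr; exact: lt_trans dx.
have [_ <-] := dF x; have [_ <-] := near_eq_is_derive F0x (is_derive_cst (0 : R) x 1).
by [].
Unshelve. all: by end_near. Qed.

(** A point where two continuous functions differ is the centre of a ball of such points, which has
    positive measure. *)
Lemma ae_eq_continuous f g : continuous f -> continuous g ->
  {ae mu, forall x, f x = g x} -> f = g.
Proof.
move=> cf cg fg; apply/funext => x; apply/eqP; apply: contrapT => /negP fgx.
have h0 : f x - g x != 0 by rewrite subr_eq0.
have ch : {for x, continuous (fun y => f y - g y)} by apply: cvgB; [exact: cf|exact: cg].
have /nbhs_ballP[e /= e0 he] : \forall y \near x, f y - g y != 0 by exact: cvgr_neq0 ch h0.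
have : mu.-negligible (ball x e).
  apply: negligibleS fg => y /he /=; rewrite subr_eq0 => /eqP h1 h2; exact: h1.
move=> neg; have : lebesgue_measure (ball x e) = 0%E.
  exact: (negligibleP mu (measurable_ball x e)).1 neg.
rewrite lebesgue_measure_ball ?ltW// => /eqP.
by rewrite eqe mulrn_eq0/= gt_eqF.
Qed.

Lemma integrable_cst_eq0 c : mu.-integrable setT (EFin \o (fun=> c)) -> c = 0.
Proof.
move=> /integrableP[_]; rewrite integral_cst//= -set_itvNyy lebesgue_measure_itv/=.
have [//|c0] := eqVneq c 0.
by rewrite gt0_muley ?ltxx// lte_fin normr_gt0.
Qed.

(** The integral over [[- n, n]] is [F n - F (- n)], at most [2 C]; monotone convergence passes to
    the line. *)
Lemma integrable_derive_bounded F f C : continuous f -> (forall x, 0 <= f x) ->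
  (forall x, is_derive x 1 F (f x)) -> (forall x, `|F x| <= C) ->
  mu.-integrable setT (EFin \o f).
Proof.
move=> cf f0 dF FC.
have mf : measurable_fun setT (EFin \o f).
  by apply/measurable_EFinP; exact: continuous_measurable_fun.
apply/integrableP; split => //.
pose I (n : nat) := `[- n%:R, n%:R]%classic : set R.
have UI : \bigcup_n I n = setT.
  apply/seteqP; split => // x _; exists (Num.truncn `|x|).+1 => //=.
  by rewrite /I /= in_itv/= -ler_norml ltW// truncnS_gt.
have ndI : nondecreasing_seq I.
  move=> m n mn; apply/subsetPset => x; rewrite /I /= !in_itv/= => /andP[h1 h2].
  by rewrite (le_trans _ h1) ?(le_trans h2) ?lerN2 ?ler_nat.
have mI n : measurable (I n) by exact: measurable_itv.
have mf' n : measurable_fun (I n) (EFin \o (fun x => `|f x|)).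
  apply/measurable_EFinP; apply: measurableT_comp => //.
  by apply: measurable_funTS; exact: continuous_measurable_fun.
have cv : (\int[mu]_(x in I n) `|f x|%:E)%E @[n --> \oo] --> (\int[mu]_x `|f x|%:E)%E.
  rewrite -UI; apply: ge0_nondecreasing_set_cvg_integral => //.
apply: (@le_lt_trans _ _ (C + C)%:E); last by rewrite ltry.
apply: cvge_le cv; near=> n => /=.
have n0 : - n%:R <= n%:R :> R by rewrite (@le_trans _ _ 0) ?oppr_le0.
have If : mu.-integrable (I n) (EFin \o f) by exact: continuous_locint.
have -> : (\int[mu]_(x in I n) `|f x|%:E)%E = (F n%:R - F (- n%:R))%:E.
  rewrite -(Rintegral_FTC2 n0 cf dF) /Rintegral fineK; last first.
    by apply: (integrable_fin_num _ If); exact: measurable_itv.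
  by apply: eq_integral => x _; rewrite /= ger0_norm.
rewrite lee_fin; have := FC n%:R; have := FC (- n%:R); rewrite !ler_norml; lra.
Unshelve. all: by end_near. Qed.

End Integrals.

(** * Smooth steps *)

Section Step.
Variable R : realType.
Local Notation mu := (@lebesgue_measure R).
Implicit Types (f g : R -> R) (a b x e : R).

Definition rho : R -> R := bump 1 0.
Definition sigma : R -> R := prim rho.
(** The steps are not normalized: this mass is carried along as a positive factor. *)
Definition rho_mass : R := sigma 1.

Lemma continuous_bump p m : continuous (@bump R p m).
Proof. exact: continuous_is_derive (is_derive_bump p m). Qed.

Lemma is_derive_sigma x : is_derive x 1 sigma (rho x).
Proof.
by apply: is_derive_prim; [apply: continuous_locint|]; exact: continuous_bump.
Qed.

Lemma rho_ge0 x : 0 <= rho x.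
Proof.
rewrite /rho /bump; case: ifP => // _.
by rewrite /bump_in hornerC expr0 divr1 mul1r expR_ge0.
Qed.

Lemma rho_le1 x : rho x <= 1.
Proof.
rewrite /rho /bump; case: ifP => // /andP[x0 x1].
rewrite /bump_in hornerC expr0 divr1 mul1r -expR0 ler_expR oppr_le0 invr_ge0.
by rewrite bpolyE mulr_ge0 ?ltW// subr_gt0.
Qed.

Lemma rho_out x : ~~ (0 < x < 1) -> rho x = 0.
Proof. by move=> xn; rewrite /rho /bump (negbTE xn). Qed.

Lemma sigma_incr x y : x <= y -> sigma x <= sigma y.
Proof.
move=> xy; rewrite -subr_ge0 primB//; last exact: continuous_locint (@continuous_bump _ _).
by apply: Rintegral_ge0 => t _; exact: rho_ge0.
Qed.

Lemma sigmaB x y : x <= y -> (forall t, x <= t <= y -> rho t = 0) -> sigma x = sigma y.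
Proof.
move=> xy h; apply/eqP; rewrite eq_sym -subr_eq0 primB//; last first.
  exact: continuous_locint (@continuous_bump _ _).
rewrite (@eq_Rintegral _ _ _ _ _ (fun=> 0)) ?Rintegral_cst ?mul0r//.
by move=> t; rewrite inE/= in_itv/= => /h.
Qed.

Lemma sigma_le0 x : x <= 0 -> sigma x = 0.
Proof.
move=> x0; rewrite (sigmaB x0) => [|t /andP[_ t0]].
  by rewrite /sigma /prim subrr.
by rewrite rho_out// negb_and -leNgt t0.
Qed.

Lemma sigma_ge1 x : 1 <= x -> sigma x = rho_mass.
Proof.
move=> x1; rewrite -(sigmaB x1)// => t /andP[t1 _].
by rewrite rho_out// negb_and -!leNgt t1 orbT.
Qed.

Lemma sigma_ge0 x : 0 <= sigma x.
Proof.
have [x0|x0] := leP x 0; first by rewrite sigma_le0.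
by rewrite -(sigma_le0 (lexx 0)) sigma_incr// ltW.
Qed.

Lemma sigma_le x : sigma x <= rho_mass.
Proof.
have [x0|x0] := leP 1 x; first by rewrite sigma_ge1.
by rewrite sigma_incr// ltW.
Qed.

Lemma rho_mass_gt0 : 0 < rho_mass.
Proof.
rewrite lt_neqAle sigma_ge0 andbT; apply/eqP => m0.
have s0 x : sigma x = 0 by apply/eqP; rewrite eq_le sigma_ge0 m0 sigma_le.
have [_] := is_derive_sigma (1 / 2); have -> : sigma = cst 0 by apply/funext.
rewrite derive_cst => /esym/eqP; rewrite /rho /bump ifT; last by apply/andP; split; lra.
by rewrite /bump_in hornerC expr0 divr1 mul1r gt_eqF ?expR_gt0.
Qed.

Definition resc a e x := e^-1 * (x - a).

Lemma is_derive_resc a e f df x : is_derive (resc a e x) 1 f df ->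
  is_derive x 1 (fun t => f (resc a e t)) (e^-1 * df).
Proof.
move=> hf; have hr : is_derive x 1 (resc a e) e^-1.
  have := is_deriveZf e^-1 (is_deriveBf (is_derive_id x 1) (is_derive_cst (a : R) x 1)).
  by rewrite subr0 mulr1.
by have := @is_derive1_comp _ f (resc a e) x _ _ hf hr; rewrite mulrC.
Qed.

(** For [0 < e] and [a + e <= b]: rises from 0 to [rho_mass] on [[a, a + e]] and falls back to 0 on
    [[b, b + e]]. *)
Definition step a b e x := sigma (resc a e x) - sigma (resc b e x).
(** The shape shared by all derivatives of [step] and stable under differentiation; [n] counts the
    derivatives taken, each of which costs a factor [1 / e]. *)
Definition bumps a b e p m (n : nat) x :=
  e ^- n * (bump p m (resc a e x) - bump p m (resc b e x)).

Lemma is_derive_step a b e x : is_derive x 1 (step a b e) (bumps a b e 1 0 1 x).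
Proof.
have h c : is_derive x 1 (fun t => sigma (resc c e t)) (e^-1 * rho (resc c e x)).
  by apply: is_derive_resc; exact: is_derive_sigma.
by have := is_deriveBf (h a) (h b); rewrite -mulrBr.
Qed.

Lemma is_derive_bumps a b e p m n x :
  is_derive x 1 (bumps a b e p m n) (bumps a b e (dbump p m) m.+2 n.+1 x).
Proof.
have h c : is_derive x 1 (fun t => bump p m (resc c e t)) (e^-1 * bump (dbump p m) m.+2 (resc c e x)).
  by apply: is_derive_resc; exact: is_derive_bump.
have := is_deriveZf (e ^- n) (is_deriveBf (h a) (h b)).
by rewrite -mulrBr mulrA -invfM -exprSr.
Qed.

Lemma derive1n_step a b e n : exists p m, derive1n n.+1 (step a b e) = bumps a b e p m n.+1.
Proof.
elim: n => [|n [p [m IH]]].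
  by exists 1, 0%N; rewrite derive1n1; apply: derive1_is_derive => x; exact: is_derive_step.
exists (dbump p m), m.+2; rewrite derive1nS IH; apply: derive1_is_derive => x.
exact: is_derive_bumps.
Qed.

Lemma resc_le0 a e x : 0 < e -> x <= a -> resc a e x <= 0.
Proof. by move=> e0 xa; rewrite /resc pmulr_rle0 ?invr_gt0// subr_le0. Qed.

Lemma resc_ge1 a e x : 0 < e -> a + e <= x -> 1 <= resc a e x.
Proof. by move=> e0 ax; rewrite /resc mulrC ler_pdivlMr// mul1r lerBrDl. Qed.

Lemma step_out a b e x : 0 < e -> a <= b -> ~~ (a < x < b + e) -> step a b e x = 0.
Proof.
move=> e0 ab; rewrite negb_and -!leNgt /step => /orP[xa|bx].
  by rewrite !sigma_le0 ?subrr ?resc_le0// (le_trans xa).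
have ae : a + e <= x by apply: le_trans bx; rewrite lerD2r.
by rewrite !sigma_ge1 ?subrr ?resc_ge1.
Qed.

Lemma test_step a b e : 0 < e -> a <= b -> test_function (step a b e).
Proof.
move=> e0 ab; split.
  case=> [|n] x; first by have [] := is_derive_step a b e x.
  by have [p [m ->]] := derive1n_step a b e n; have [] := is_derive_bumps a b e p m n.+1 x.
exists (`|a| + `|b| + e) => x hx; apply: step_out => //; apply/negP => /andP[ax xb].
move: hx; apply/negP; rewrite -leNgt ler_norml.
have := ler_norm a; have := ler_norm b; have := ler_norm (- a); rewrite normrN.
have := normr_ge0 a; have := normr_ge0 b; lra.
Qed.

End Step.

(** * Weak derivatives on the line *)

Section Leb.
Variable R : realType.
Local Notation mu := (@lebesgue_measure R).
Implicit Types (f g : R -> R) (a b x e : R).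

(** The averages in [lebesgue_pt] are over balls. The open ball of radius [2 e] about [a] contains
    [[a, a + e]] and has measure [4 e], which explains the [eps / 4] in the proof. *)
Lemma lebesgue_pt_avg f a (eps : R) : measurable_fun setT f -> locint f ->
  lebesgue_pt f a -> 0 < eps ->
  \forall e \near 0^'+, \int[mu]_(x in `[a, a + e]) `|f x - f a| <= eps * e.
Proof.
move=> mf lf lfa eps0.
have mfa : measurable_fun setT (fun x => `|f x - f a|).
  by apply: measurableT_comp => //; apply: measurable_funB.
have [d /= d0 hd] : \forall r \near 0^'+, (davg f a r <= (eps / 4)%:E)%E.
  have e4 : 0 < eps / 4 by rewrite divr_gt0.
  have : nbhs (0 : \bar R)%E (fun u => (u < (eps / 4)%:E)%E) by apply: open_ereal_lt'; rewrite lte_fin.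
  move=> /lfa h; have {}h : \forall r \near 0^'+, (davg f a r < (eps / 4)%:E)%E by exact: h.
  by near do apply: ltW.
exists (d / 2) => /=; first by rewrite divr_gt0.
move=> e /=; rewrite sub0r normrN => ed e0; rewrite gtr0_norm// in ed.
have := hd (2 * e); rewrite /= sub0r normrN gtr0_norm ?mulr_gt0// => /(_ _ _)/wrap[].
- by rewrite mulrC -ltr_pdivlMr.
- by [].
have r0 : 0 <= 2 * e by rewrite mulr_ge0 ?(ltW e0).
rewrite /davg /iavg lebesgue_measure_ball// inver ifF; last first.
  by rewrite mulrn_eq0 mulf_eq0 !pnatr_eq0/= gt_eqF.
set J := (\int[mu]_(y in _) _)%E => hJ.
have {hJ} : (J <= (eps * e)%:E)%E.
  have -> : eps * e = (eps / 4) * (2 * e *+ 2) by rewrite mulr2n; field.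
  move: hJ; rewrite lee_pdivrMl; last by rewrite pmulrn_lgt0 ?mulr_gt0.
  by rewrite -EFinM mulrC.
have : (\int[mu]_(x in `[a, (a + e)%R]) `|f x - f a|%:E <= J)%E.
  rewrite /J; apply: ge0_subset_integral => //.
  - exact: measurable_ball.
  - by apply/measurable_EFinP; apply: measurable_funTS.
  - move=> x /=; rewrite in_itv/= -ball_normE /ball_ => /andP[ax xe] /=.
    by rewrite distrC ger0_norm ?subr_ge0//; lra.
move=> h1 h2; have {h1 h2} := le_trans h1 h2.
have I : mu.-integrable `[a, a + e] (EFin \o (fun x => `|f x - f a|)).
  apply: integrable_norm; apply: integrableBf; [exact: measurable_itv|exact: lf|].
  exact: (continuous_locint (@cst_continuous _ _ _)).
rewrite /Rintegral -lee_fin fineK//.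
by apply: (integrable_fin_num _ I); exact: measurable_itv.
Unshelve. all: by end_near. Qed.

End Leb.

Section WeakIncr.
Variable R : realType.
Local Notation mu := (@lebesgue_measure R).
Implicit Types (f g k : R -> R) (a b x e C : R).

Lemma locint_norm f : locint f -> locint (fun x => `|f x|).
Proof. by move=> lf a b; exact: integrable_norm. Qed.

Lemma locint_mulb f k C : locint f -> measurable_fun setT k -> (forall x, `|k x| <= C) ->
  locint (fun x => f x * k x).
Proof.
move=> lf mk kC a b; apply: (integrableMb (C := C)) => //; exact: measurable_funTS.
Qed.

Lemma locint_sub f g : locint f -> locint g -> locint (fun x => f x - g x).
Proof. by move=> lf lg a b; apply: integrableBf. Qed.

Lemma locint_cst (c : R) : locint (fun=> c).
Proof. by apply: continuous_locint; exact: cst_continuous. Qed.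

Lemma norm_Rintegral_mulb f k C a b : locint f -> measurable_fun setT k ->
  (forall x, `|k x| <= C) ->
  `|\int[mu]_(x in `[a, b]) (f x * k x)| <= C * \int[mu]_(x in `[a, b]) `|f x|.
Proof.
move=> lf mk kC; have lfk := locint_mulb lf mk kC.
apply: (le_trans (le_normr_Rintegral _ (lfk a b))); first exact: measurable_itv.
rewrite -RintegralZl; [|exact: measurable_itv|exact: locint_norm].
apply: le_Rintegral => [||| x _]; first exact: measurable_itv.
- exact: locint_norm.
- by apply: integrableZf; [exact: measurable_itv|exact: locint_norm].
- by rewrite normrM mulrC ler_wpM2r.
Qed.

Lemma Rintegral_itv_small f a (eps : R) : locint f -> 0 < eps ->
  \forall e \near 0^'+, \int[mu]_(x in `[a, a + e]) `|f x| <= eps.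
Proof.
move=> lf eps0; have lf' := locint_norm lf.
have h : prim (fun x => `|f x|) (a + e) @[e --> (0 : R)^'+] --> prim (fun x => `|f x|) a.
  apply: (@cvg_comp _ _ _ (fun e : R => a + e) _ _ (nbhs a)); last exact: continuous_prim.
  have : a + e @[e --> (0 : R)^'+] --> a + 0.
    by apply: cvg_at_right_filter; apply: cvgD; [exact: cvg_cst|exact: cvg_id].
  by rewrite addr0.
near=> e; rewrite -primB//; last by rewrite lerDl.
apply: (le_trans (ler_norm _)); rewrite distrC; near: e.
exact: (cvgrPdist_le _ _).1 h eps eps0.
Unshelve. all: by end_near. Qed.

(** The rising half of the derivative of [step a b e]: an approximate Dirac mass at [a], of total
    mass [rho_mass]. *)
Definition kern a e x : R := e^-1 * rho (resc a e x).

Lemma continuous_resc a e : continuous (resc a e : R -> R).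
Proof.
move=> x; apply: cvgM; first exact: cvg_cst.
by apply: cvgB; [exact: cvg_id|exact: cvg_cst].
Qed.

Lemma continuous_kern a e : continuous (kern a e).
Proof.
move=> x; apply: cvgM; first exact: cvg_cst.
by apply: (@cvg_comp _ _ _ (resc a e) (@rho R) _ (nbhs (resc a e x)));
  [exact: continuous_resc|exact: continuous_bump].
Qed.

Lemma kern_bound a e x : 0 < e -> `|kern a e x| <= e^-1.
Proof.
move=> e0; rewrite /kern normrM gtr0_norm ?invr_gt0// ler_piMr ?invr_ge0 ?(ltW e0)//.
by rewrite ger0_norm ?rho_ge0 ?rho_le1.
Qed.

Lemma kern_out a e x : 0 < e -> ~~ (a <= x <= a + e) -> kern a e x = 0.
Proof.
move=> e0 xn; rewrite /kern rho_out ?mulr0//; apply: contraNN xn => /andP[h1 h2].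
move: h1 h2; rewrite /resc pmulr_rgt0 ?invr_gt0// subr_gt0 => ax.
by rewrite mulrC ltr_pdivrMr// mul1r => h2; rewrite ltW//=; lra.
Qed.

Lemma Rintegral_supp2 (h : R -> R) a b u w : u <= a -> b <= w ->
  (forall x, ~~ (a <= x <= b) -> h x = 0) ->
  \int[mu]_(x in `[u, w]) h x = \int[mu]_(x in `[a, b]) h x.
Proof.
move=> ua bw h0; rewrite -(Rintegral_supp h0) (@Rintegral_supp _ _ u w)// => x xn.
by apply: h0; apply: contraNN xn => /andP[h1 h2]; rewrite (le_trans ua) ?(le_trans h2).
Qed.

(** Since the kernel has integral [rho_mass], the difference is the integral of [(f - f a) kern],
    and the kernel is at most [1 / e]. *)
Lemma kern_approx f a e u w : locint f -> 0 < e -> u <= a -> a + e <= w ->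
  `|\int[mu]_(x in `[u, w]) (f x * kern a e x) - rho_mass R * f a|
    <= e^-1 * \int[mu]_(x in `[a, a + e]) `|f x - f a|.
Proof.
move=> lf e0 ua aw.
have mk : measurable_fun setT (kern a e) by apply: continuous_measurable_fun; exact: continuous_kern.
have ke x : `|kern a e x| <= e^-1 by exact: kern_bound.
have ae : a <= a + e by rewrite lerDl ltW.
have k1 : \int[mu]_(x in `[a, a + e]) kern a e x = rho_mass R.
  have dk x : is_derive x 1 (fun t => sigma (resc a e t)) (kern a e x).
    by apply: is_derive_resc; exact: is_derive_sigma.
  rewrite (Rintegral_FTC2 ae (@continuous_kern a e) dk).
  by rewrite sigma_ge1 ?resc_ge1// sigma_le0 ?resc_le0// subr0.
rewrite (Rintegral_supp2 ua aw); last by move=> x xn; rewrite kern_out ?mulr0.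
rewrite -k1 [_ * f a]mulrC -RintegralZl; [|exact: measurable_itv|]; last first.
  exact: (continuous_locint (@continuous_kern a e)).
rewrite -RintegralB; [|exact: measurable_itv| |]; last 2 first.
- exact: (locint_mulb lf mk ke).
- by apply: integrableZf; [exact: measurable_itv|exact: (continuous_locint (@continuous_kern a e))].
under eq_Rintegral do rewrite -mulrBl.
apply: norm_Rintegral_mulb => //.
by apply: locint_sub => //; exact: locint_cst.
Qed.

Lemma continuous_step a b e : continuous (@step R a b e).
Proof. exact: continuous_is_derive (is_derive_step a b e). Qed.

(** The step and [rho_mass] times the indicator of [[a, b]] differ only on the two segments of
    length [e], by at most [rho_mass]. *)
Lemma step_approx g a b e : locint g -> 0 < e -> a + e <= b ->
  `|\int[mu]_x (g x * step a b e x) - rho_mass R * \int[mu]_(x in `[a, b]) g x|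
   <= rho_mass R * (\int[mu]_(x in `[a, a + e]) `|g x| + \int[mu]_(x in `[b, b + e]) `|g x|).
Proof.
move=> lg e0 ab; have a_b : a <= b by lra.
have ms : measurable_fun setT (step a b e) by apply: continuous_measurable_fun; exact: continuous_step.
have resc_le x : resc b e x <= resc a e x.
  by rewrite /resc ler_pM2l ?invr_gt0//; lra.
have s0 x : 0 <= step a b e x by rewrite subr_ge0 sigma_incr.
have s1 x : step a b e x <= rho_mass R.
  by have := sigma_le (resc a e x); have := sigma_ge0 (resc b e x); rewrite /step; lra.
have sb x : `|step a b e x| <= rho_mass R by rewrite ger0_norm.
have sb' x : `|step a b e x - rho_mass R| <= rho_mass R.
  by rewrite ler_norml; have := s0 x; have := s1 x; lra.
have lgs := locint_mulb lg ms sb.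
rewrite (@Rintegral_supp _ _ a (b + e)); last first.
  move=> x xn; rewrite step_out ?mulr0//; apply: contraNN xn.
  by case/andP => *; rewrite !ltW.
have [l1 l2 l3 l4] : [/\ a <= a + e, a + e <= b + e, a + e <= b & b <= b + e] by split; lra.
rewrite (Rintegral_itv_cat lgs l1 l2) (Rintegral_itv_cat lgs l3 l4) (Rintegral_itv_cat lg l1 l3).
have -> : \int[mu]_(x in `[a + e, b]) (g x * step a b e x) =
          rho_mass R * \int[mu]_(x in `[a + e, b]) g x.
  rewrite -RintegralZl//; apply: eq_Rintegral => x; rewrite inE/= in_itv/= => /andP[h1 h2].
  by rewrite /step sigma_ge1 ?resc_ge1// sigma_le0 ?resc_le0// subr0 mulrC.
have -> : \int[mu]_(x in `[a, a + e]) (g x * step a b e x) =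
    \int[mu]_(x in `[a, a + e]) (g x * (step a b e x - rho_mass R)) +
    rho_mass R * \int[mu]_(x in `[a, a + e]) g x.
  rewrite -RintegralZl// -RintegralD//.
  - by apply: eq_Rintegral => x _; ring.
  - apply: (locint_mulb (C := rho_mass R)) => //.
    by apply: measurable_funB.
  - exact: integrableZf.
have hY := norm_Rintegral_mulb b (b + e) lg ms sb.
have ms' : measurable_fun setT (fun x => step a b e x - rho_mass R) by exact: measurable_funB.
have hX := norm_Rintegral_mulb a (a + e) lg ms' sb'.
move: hX hY; set X := \int[mu]_(x in _) _; set Y := \int[mu]_(x in `[b, b + e]) (_ * _) => hX hY.
rewrite [leRHS]mulrDr; apply: le_trans (lerD hX hY); apply: le_trans (ler_normD _ _).
by rewrite le_eqVlt; apply/orP; left; apply/eqP; congr (`| _ |); ring.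
Qed.

(** Tested against [step a b e] as [e] tends to 0, the left side tends to [rho_mass (f a - f b)], as
    [a] and [b] are Lebesgue points, and the right side to [- rho_mass] times the integral of
    [g]. *)
Lemma weak_derivative_incr f g a b : measurable_fun setT f -> locint f -> locint g ->
  weak_derivative f g -> lebesgue_pt f a -> lebesgue_pt f b -> a < b ->
  f b - f a = \int[mu]_(x in `[a, b]) g x.
Proof.
move=> mf lf lg fg fa fb ab; apply/eqP; rewrite -subr_eq0 -normr_eq0 eq_le normr_ge0 andbT.
set m := rho_mass R; have m0 : 0 < m by exact: rho_mass_gt0.
rewrite -(pmulr_rle0 _ m0) -[X in X * _]gtr0_norm// -normrM.
apply/ler_addgt0Pl => eps eps0; rewrite addr0.
have ab0 : 0 < b - a by rewrite subr_gt0.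
have e4 : 0 < eps / 4 by rewrite divr_gt0.
have e4m : 0 < eps / (4 * m) by rewrite divr_gt0 ?mulr_gt0.
(* Error budget: [eps / 4] for each of the two kernels and [eps / 2] for the step, the latter shared
   by two segments and divided by the factor [m]. *)
have [e [e0 eab ha hb]] : exists e, [/\ 0 < e, e <= b - a,
   (\int[mu]_(x in `[a, a + e]) `|f x - f a| <= eps / 4 * e) /\
   (\int[mu]_(x in `[b, b + e]) `|f x - f b| <= eps / 4 * e) &
   (\int[mu]_(x in `[a, a + e]) `|g x| <= eps / (4 * m)) /\
   (\int[mu]_(x in `[b, b + e]) `|g x| <= eps / (4 * m))].
  near (0 : R)^'+ => e; exists e; split => //.
  - by near: e; exact: nbhs_right_le.
  - by split; near: e; apply: lebesgue_pt_avg.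
  - by split; near: e; apply: Rintegral_itv_small.
have aeb : a + e <= b by lra.
have [[fa1 fb1] [ga1 gb1]] := (ha, hb).
have := fg _ (test_step e0 (ltW ab)); rewrite (derive1_is_derive (is_derive_step a b e)).
have -> : \int[mu]_x (f x * bumps a b e 1 0 1 x) =
    \int[mu]_(x in `[a, b + e]) (f x * kern a e x) - \int[mu]_(x in `[a, b + e]) (f x * kern b e x).
  have kb c x : `|kern c e x| <= e^-1 by exact: kern_bound.
  have mk c : measurable_fun setT (kern c e) by apply: continuous_measurable_fun; exact: continuous_kern.
  rewrite (@Rintegral_supp _ _ a (b + e)).
    rewrite -RintegralB//; try exact: (locint_mulb lf (mk _) (kb _)).
    by apply: eq_Rintegral => x _; rewrite -mulrBr /bumps /kern -mulrBr.
  move=> x xn; rewrite (_ : bumps _ _ _ _ _ _ _ = kern a e x - kern b e x); last first.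
    by rewrite /bumps /kern -mulrBr.
  rewrite !kern_out ?subrr ?mulr0//; apply: contraNN xn => /andP[h1 h2]; apply/andP; split; lra.
have := kern_approx lf e0 (lexx a) (_ : a + e <= b + e); rewrite lerD2r => /(_ (ltW ab)).
have := kern_approx lf e0 (ltW ab) (lexx (b + e)).
have := step_approx lg e0 aeb; rewrite -/m.
set A1 := \int[mu]_(x in _) (f x * kern b e x).
set A2 := \int[mu]_(x in _) (f x * kern a e x).
set G := \int[mu]_x (g x * step a b e x); set I := \int[mu]_(x in `[a, b]) g x.
move=> hG hA1 hA2 hE.
have {}hA1 : `|A1 - m * f b| <= eps / 4.
  by apply: (le_trans hA1); rewrite ler_pdivrMl// mulrC.
have {}hA2 : `|A2 - m * f a| <= eps / 4.
  by apply: (le_trans hA2); rewrite ler_pdivrMl// mulrC.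
have {}hG : `|G - m * I| <= eps / 2.
  apply: (le_trans hG); rewrite mulrC -ler_pdivlMr//.
  have -> : eps / 2 / m = eps / (4 * m) + eps / (4 * m) by field; rewrite gt_eqF.
  exact: lerD.
move: hA1 hA2 hG; rewrite !ler_norml => /andP[? ?] /andP[? ?] /andP[? ?].
by apply/andP; split; nra.
Unshelve. all: by end_near. Qed.

End WeakIncr.

Section WeakAC.
Variable R : realType.
Local Notation mu := (@lebesgue_measure R).
Implicit Types (f g h psi : R -> R) (a b x e C : R).

Lemma locint_locally_integrable f : measurable_fun setT f -> locint f ->
  locally_integrable setT f.
Proof.
move=> mf lf; split => //; first exact: openT.
move=> K _ cK; have [M [_ hM]] := compact_bounded cK.
pose A := `|M| + 1; have KA x : K x -> `|x| <= A.
  by move=> Kx; apply: hM => //; rewrite (le_lt_trans (ler_norm _))// ltrDl.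
have /integrableP[_] := integrable_norm (lf (- A) A).
apply: le_lt_trans.
under [leRHS]eq_integral do rewrite /= normr_id.
apply: ge0_subset_integral => //.
- exact: compact_measurable.
- by apply/measurable_EFinP; apply: measurable_funTS; exact: measurableT_comp.
- by move=> x /KA; rewrite /= in_itv/= ler_norml.
Qed.

(** If [P] failed everywhere, the constants 0 and 1 would agree almost everywhere. *)
Lemma ae_ex (P : R -> Prop) : {ae mu, forall x, P x} -> exists x, P x.
Proof.
move=> aeP; apply: contrapT => nP; have nPx x : ~ P x by move=> Px; apply: nP; exists x.
have : (fun=> 0) = (fun=> 1) :> (R -> R).
  apply: ae_eq_continuous; [exact: cst_continuous|exact: cst_continuous|].
  have F := ae_filter_ringOfSetsType mu.
  by apply: filterS aeP => x /nPx.
by move/(congr1 (fun f => f 0))/eqP; rewrite eq_sym oner_eq0.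
Qed.

Lemma weak_derivative_ac f g : measurable_fun setT f -> locint f -> locint g ->
  weak_derivative f g ->
  exists F, [/\ continuous F, {ae mu, forall x, f x = F x} &
    forall a b, a <= b -> F b - F a = \int[mu]_(x in `[a, b]) g x].
Proof.
move=> mf lf lg fg.
have aeL := lebesgue_differentiation (locint_locally_integrable mf lf).
have [c fc] := ae_ex aeL.
(* The Lebesgue point [c] anchors the representative; [weak_derivative_incr] shows that it equals
   [f] at every Lebesgue point. *)
exists (fun x => f c + (prim g x - prim g c)); split.
- move=> x; apply: cvgD; first exact: cvg_cst.
  by apply: cvgB; [exact: continuous_prim|exact: cvg_cst].
- have FF := ae_filter_ringOfSetsType mu.
  apply: filterS aeL => x fx; have [xc|cx|->] := ltgtP x c; last by rewrite subrr addr0.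
    have := weak_derivative_incr mf lf lg fg fx fc xc; rewrite -primB ?ltW//.
    by move=> ?; lra.
  have := weak_derivative_incr mf lf lg fg fc fx cx; rewrite -primB ?ltW//.
  by move=> ?; lra.
- by move=> a b ab; rewrite -primB//; ring.
Qed.

Lemma is_derive_incr F g : continuous g ->
  (forall a b, a <= b -> F b - F a = \int[mu]_(x in `[a, b]) g x) ->
  forall x, is_derive x 1 F (g x).
Proof.
move=> cg Fg x; have lg := continuous_locint cg.
rewrite (_ : F = fun t => F 0 - prim g 0 + prim g t).
  have := is_deriveDf (is_derive_cst (F 0 - prim g 0 : R) x 1) (is_derive_prim lg (cg x)).
  by rewrite add0r.
apply/funext => t; have [t0|t0] := leP 0 t.
  by have := Fg _ _ t0; rewrite -primB// => ?; lra.
by have := Fg _ _ (ltW t0); rewrite -primB ?ltW// => ?; lra.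
Qed.

Lemma test_continuous psi n : test_function psi -> continuous (derive1n n psi).
Proof.
by move=> [h _] x; apply/differentiable_continuous/derivable1_diffP.
Qed.

Lemma test_is_derive psi n x : test_function psi ->
  is_derive x 1 (derive1n n psi) (derive1n n.+1 psi x).
Proof. by move=> [h _]; rewrite derive1nS derive1E; exact: derivableP. Qed.

Lemma test_derive1 psi : test_function psi -> test_function (derive1 psi).
Proof.
move=> [h [A psiA]]; split=> [n x|]; first by rewrite -derive1Sn.
exists A => x Ax; rewrite derive1E.
have F0x : \forall y \near x, 0 = psi y.
  have h1 : (fun y : R => `|y|) @ x --> `|x| by apply: cvg_norm; exact: cvg_id.
  near=> y; rewrite psiA//; near: y; exact: cvgr_gt h1 _ Ax.
by have [_ <-] := near_eq_is_derive F0x (is_derive_cst (0 : R) x 1).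
Unshelve. all: by end_near. Qed.

Lemma test_derive1n psi n : test_function psi -> test_function (derive1n n psi).
Proof. by move=> h; elim: n => // n IH; rewrite derive1nS; exact: test_derive1. Qed.

Lemma integrable_supp h a b : locint h -> (forall x, ~~ (a <= x <= b) -> h x = 0) ->
  mu.-integrable setT (EFin \o h).
Proof.
move=> lh h0.
have : mu.-integrable setT ((EFin \o h) \_ `[a, b]).
  by apply: (integrable_mkcond _ _).1 (lh a b); exact: measurable_itv.

congr (integrable _ _); apply/funext => x; rewrite patchE; case: ifPn => //= xab.
rewrite h0//; apply: contraNN xab => xab; by rewrite inE/= in_itv.
Qed.

Lemma test_bounded psi : test_function psi -> exists C, forall x, `|psi x| <= C.
Proof.
move=> tpsi; have cpsi := test_continuous (n := 0) tpsi; case: tpsi => _ [A psiA].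
have [M [_ hM]] : bounded_set (psi @` `[- A, A]).
  apply: compact_bounded; apply: continuous_compact; last exact: segment_compact.
  exact: continuous_subspaceT.
exists (`|M| + 1) => x; have [xA|xA] := leP `|x| A.
  apply: hM; first by rewrite (le_lt_trans (ler_norm _))// ltrDl.
  by exists x => //=; rewrite in_itv/= -ler_norml.
by rewrite psiA// normr0 addr_ge0.
Qed.

Lemma test_integrable f psi : locint f -> test_function psi ->
  mu.-integrable setT (EFin \o (fun x => f x * psi x)).
Proof.
move=> lf tpsi; have [C hC] := test_bounded tpsi.
have mpsi := continuous_measurable_fun (test_continuous (n := 0) tpsi).
have [_ [A psiA]] := tpsi; apply: (@integrable_supp _ (- A) A).
  exact: (locint_mulb lf mpsi hC).
by move=> x; rewrite -ler_norml -ltNge => /psiA ->; rewrite mulr0.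
Qed.

End WeakAC.

(** * Linear second-order systems *)

Section System.
Variables (R : realType) (n : nat) (A : R -> 'M[R]_n) (B : R).
Local Notation mu := (@lebesgue_measure R).
Hypothesis A_sym : forall x, (A x)^T = A x.
Hypothesis A_cont : forall i j, continuous (fun x => A x i j).
Hypothesis A_bound : forall x i j, `|A x i j| <= B.
Implicit Types (p q r s : 'I_n -> R -> R).

Definition rhs p i x := \sum_l A x i l * p l x.

Definition classical_sol p q :=
  (forall i (x : R), is_derive x 1 (p i) (q i x)) /\
  (forall i (x : R), is_derive x 1 (q i) (rhs p i x)).

Definition L2_sol p q :=
  classical_sol p q /\ ((forall i, L2 (p i)) /\ (forall i, L2 (q i))).

Lemma nincr_derive (F f : R -> R) : (forall x : R, is_derive x 1 F (f x)) ->
  (forall x, f x <= 0) -> forall x y, x <= y -> F y <= F x.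
Proof.
move=> dF f0 x y xy; rewrite -subr_le0.
have [c _ ->] : exists2 c, c \in `[x, y] & F y - F x = f c * (y - x).
  apply: MVT_segment => //; apply: continuous_subspaceT.
  exact: continuous_is_derive dF.
by rewrite mulr_le0_ge0 ?subr_ge0.
Qed.

Definition energy p q x := \sum_i (p i x ^+ 2 + q i x ^+ 2).

Lemma energy_ge p q i x : p i x ^+ 2 + q i x ^+ 2 <= energy p q x.
Proof.
rewrite /energy (bigD1 i)//= lerDl sumr_ge0// => j _.
by rewrite addr_ge0 ?sqr_ge0.
Qed.

Lemma is_derive_sqrf (f : R -> R) (x df : R) : is_derive x 1 f df ->
  is_derive x 1 (fun t => f t ^+ 2) (2 * f x * df).
Proof.
move=> df1; have := is_deriveMf df1 df1.
have -> : df * f x + f x * df = 2 * f x * df by ring.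
by [].
Qed.

(** Each of the [n] components contributes at most one energy from [2 p q], and from [2 q (A p)] at
    most [2 |B|] energies for each of the [n] entries of its row. *)
Definition growth : R := n%:R * (1 + 2 * n%:R * `|B|).

Lemma energy_derive p q (x : R) : classical_sol p q ->
  exists2 e : R, is_derive x 1 (energy p q) e & `|e| <= growth * energy p q x.
Proof.
move=> [dp dq]; exists (\sum_i (2 * p i x * q i x + 2 * q i x * rhs p i x)).
  by apply: is_derive_sumf => i; apply: is_deriveDf; exact: is_derive_sqrf.
set E := energy p q x.
have E0 : 0 <= E by rewrite sumr_ge0// => j _; rewrite addr_ge0 ?sqr_ge0.
have sqrE i : p i x ^+ 2 <= E /\ q i x ^+ 2 <= E.
  by have := energy_ge p q i x; have := sqr_ge0 (p i x); have := sqr_ge0 (q i x);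
     rewrite -/E; split; lra.
apply: (le_trans (ler_norm_sum _ _ _)).
have -> : growth * E = \sum_(i < n) (E + \sum_(l < n) 2 * `|B| * E).
  rewrite !sumr_const !card_ord -[RHS]mulr_natl -[X in E + X]mulr_natl /growth.
  by move: (n%:R : R) => m; ring.
apply: ler_sum => i _; apply: (le_trans (ler_normD _ _)); apply: lerD.
  apply: le_trans (energy_ge p q i x); rewrite ler_norml.
  have := sqr_ge0 (p i x - q i x); have := sqr_ge0 (p i x + q i x).
  by move=> ? ?; apply/andP; split; lra.
rewrite /rhs mulr_sumr (le_trans (ler_norm_sum _ _ _))//; apply: ler_sum => l _.
have AB : `|A x i l| <= `|B| by rewrite (le_trans (A_bound x i l))// ler_norm.
have -> : 2 * q i x * (A x i l * p l x) = A x i l * (2 * q i x * p l x) by ring.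
rewrite normrM [2 * `|B|]mulrC -[leRHS]mulrA; apply: ler_pM => //.
have [_ h1] := sqrE i; have [h2 _] := sqrE l.
have := sqr_ge0 (q i x - p l x); have := sqr_ge0 (q i x + p l x).
by rewrite ler_norml => ? ?; apply/andP; split; lra.
Qed.

(** Gronwall: the energy is nonincreasing after multiplication by [exp (- growth t)] and
    nondecreasing after multiplication by [exp (growth t)]; it is nonnegative and starts from 0 at
    [x0]. *)
Lemma ode_unique p q x0 : classical_sol p q ->
  (forall i, p i x0 = 0) -> (forall i, q i x0 = 0) ->
  forall i x, p i x = 0 /\ q i x = 0.
Proof.
move=> pq p0 q0.
have E0 x : 0 <= energy p q x by rewrite sumr_ge0// => j _; rewrite addr_ge0 ?sqr_ge0.
have Ex0 : energy p q x0 = 0.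
  by rewrite /energy big1// => i _; rewrite p0 q0 expr0n addr0.
have dE x := cid2 (energy_derive x pq).
pose e x := s2val (dE x).
have de (x : R) : is_derive x 1 (energy p q) (e x) by exact: s2valP (dE x).
have eE x : `|e x| <= growth * energy p q x by exact: s2valP' (dE x).
have dexp (c x : R) : is_derive x 1 (fun t => expR (c * t)) (expR (c * x) * c).
  have h := is_deriveZf c (is_derive_id x 1); rewrite mulr1 in h.
  exact: (@is_derive1_comp _ expR (fun t => c * t) x _ _ (is_derive_expR _) h).
suff Ez x : energy p q x = 0.
  move=> i x; have := energy_ge p q i x; rewrite Ez.
  have := sqr_ge0 (p i x); have := sqr_ge0 (q i x) => h1 h2 h3.
  by split; apply/eqP; rewrite -sqrf_eq0 eq_le sqr_ge0 andbT; lra.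
apply/eqP; rewrite eq_le E0 andbT; have [xx|xx] := leP x0 x.
- have d1 (t : R) : is_derive t 1 (fun t => energy p q t * expR (- growth * t))
      ((e t - growth * energy p q t) * expR (- growth * t)).
    have := is_deriveMf (de t) (dexp (- growth) t).
    have -> : e t * expR (- growth * t) + energy p q t * (expR (- growth * t) * - growth) =
      (e t - growth * energy p q t) * expR (- growth * t) by ring.
    by [].
  have h t : (e t - growth * energy p q t) * expR (- growth * t) <= 0.
    rewrite pmulr_lle0 ?expR_gt0// subr_le0; exact: le_trans (ler_norm _) (eE t).
  have := nincr_derive d1 h xx; rewrite Ex0 mul0r.
  by rewrite pmulr_lle0 ?expR_gt0.
- have d1 (t : R) : is_derive t 1 (fun t => - (energy p q t * expR (growth * t)))
      (- ((e t + growth * energy p q t) * expR (growth * t))).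
    have := is_deriveNf (is_deriveMf (de t) (dexp growth t)).
    have -> : e t * expR (growth * t) + energy p q t * (expR (growth * t) * growth) =
      (e t + growth * energy p q t) * expR (growth * t) by ring.
    by [].
  have h t : - ((e t + growth * energy p q t) * expR (growth * t)) <= 0.
    rewrite oppr_le0 pmulr_lge0 ?expR_gt0//.
    by have := eE t; rewrite ler_norml => /andP[h _]; rewrite -lerBlDr sub0r.
  have := nincr_derive d1 h (ltW xx); rewrite Ex0 mul0r oppr0 oppr_ge0.
  by rewrite pmulr_lle0 ?expR_gt0.
Qed.

Lemma wronskian_eq0 p q r s : L2_sol p q -> L2_sol r s ->
  forall x, \sum_i (p i x * s i x - q i x * r i x) = 0.
Proof.
move=> [[dp dq] [lp lq]] [[dr ds] [lr ls]].
pose w x := \sum_i (p i x * s i x - q i x * r i x).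
have dw (x : R) : is_derive x 1 w 0.
  have -> : 0 = \sum_i ((q i x * s i x + p i x * rhs r i x) - (rhs p i x * r i x + q i x * s i x)).
    (* The products [q s] cancel, and the two double sums left agree by symmetry of [A]. *)
    transitivity (\sum_i \sum_l (p i x * (A x i l * r l x)) - \sum_i \sum_l (A x i l * p l x * r i x)).
      rewrite [X in _ - X]exchange_big/= -sumrB big1// => i _; rewrite -sumrB big1// => l _.
      by rewrite -{2}(A_sym x) mxE; ring.
    rewrite -sumrB; apply: eq_bigr => i _; rewrite /rhs mulr_sumr mulr_suml; ring.
  apply: is_derive_sumf => i; apply: is_deriveBf; apply: is_deriveMf => //.
have wc x : w x = w 0 by exact: is_derive_0_is_cst.
have : mu.-integrable setT (EFin \o w).
  apply: integrable_sumf => // i; apply: integrableBf => //; exact: L2_mul.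
have -> : w = fun=> w 0 by apply/funext.
by move=> /integrable_cst_eq0 w0 x; rewrite -/(w x) wc.
Qed.

Lemma classical_sol_lin m (c : 'I_m -> R) (P Q : 'I_m -> 'I_n -> R -> R) :
  (forall j, classical_sol (P j) (Q j)) ->
  classical_sol (fun i x => \sum_j c j * P j i x) (fun i x => \sum_j c j * Q j i x).
Proof.
move=> PQ; split=> i x.
  by apply: is_derive_sumf => j; apply: is_deriveZf; exact: (PQ j).1.
have -> : rhs (fun i x => \sum_j c j * P j i x) i x = \sum_j c j * rhs (P j) i x.
  rewrite /rhs (eq_bigr (fun l => \sum_j c j * (A x i l * P j l x))).
    by rewrite exchange_big/=; apply: eq_bigr => j _; rewrite mulr_sumr.
  by move=> l _; rewrite mulr_sumr; apply: eq_bigr => j _; ring.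
by apply: is_derive_sumf => j; apply: is_deriveZf; exact: (PQ j).2.
Qed.

Lemma L2_sol_lin m (c : 'I_m -> R) (P Q : 'I_m -> 'I_n -> R -> R) :
  (forall j, L2_sol (P j) (Q j)) ->
  L2_sol (fun i x => \sum_j c j * P j i x) (fun i x => \sum_j c j * Q j i x).
Proof.
move=> PQ; split; first by apply: classical_sol_lin => j; exact: (PQ j).1.
by split=> i; apply: L2_sum => j; apply: L2Z; have [_ []] := PQ j.
Qed.

(* The solutions in L2 are pairwise in involution for the Wronskian, so their
   values at [x0] determine their derivatives there. *)
Lemma L2_sol_span (P Q : 'I_n -> 'I_n -> R -> R) p q x0 :
  (forall j, L2_sol (P j) (Q j)) ->
  (\matrix_(j, i) P j i x0) \in unitmx ->
  L2_sol p q -> exists c : 'I_n -> R, forall i x, p i x = \sum_j c j * P j i x.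
Proof.
move=> PQ; set M := \matrix_(j, i) _ => uM pq.
have [c cM] : exists c : 'rV_n, c *m M = \row_i p i x0.
  by exists ((\row_i p i x0) *m invmx M); rewrite mulmxKV.
exists (c 0).
(* The difference of [p] and the combination is itself a combination of [n.+1] solutions, with [p]
   at index [ord0], so that [L2_sol_lin] applies to it. *)
pose c' (o : 'I_n.+1) : R := oapp (fun j => - c 0 j) 1 (unlift ord0 o).
pose P' (o : 'I_n.+1) := oapp P p (unlift ord0 o).
pose Q' (o : 'I_n.+1) := oapp Q q (unlift ord0 o).
have PQ' o : L2_sol (P' o) (Q' o).
  by rewrite /P' /Q'; case: (unlift ord0 o).
have dPQ := L2_sol_lin c' PQ'.
set d := fun i x => _ in dPQ; set d' := fun i x => _ in dPQ.
have dE i x : d i x = p i x - \sum_j c 0 j * P j i x.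
  rewrite /d big_ord_recl /c' /P' unlift_none/= mul1r; congr (_ + _).
  by rewrite -sumrN; apply: eq_bigr => j _; rewrite liftK/= mulNr.
have d0 i : d i x0 = 0.
  have /rowP/(_ i) := cM; rewrite !mxE dE => <-; apply/eqP; rewrite subr_eq0; apply/eqP.
  by apply: eq_bigr => j _; rewrite mxE.
have d'0 i : d' i x0 = 0.
  (* As [d] vanishes at [x0], its Wronskian with [P j] reduces there to [- d' . P j]. *)
  have : M *m (\col_i d' i x0) = 0.
    apply/colP => j; rewrite !mxE.
    have := wronskian_eq0 dPQ (PQ j) x0.
    rewrite (eq_bigr (fun i => - (d' i x0 * P j i x0))); last first.
      by move=> k _; rewrite d0 mul0r sub0r.
    rewrite sumrN => /eqP; rewrite oppr_eq0 => /eqP; apply: etrans.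
    by apply: eq_bigr => k _; rewrite !mxE mulrC.
  move/(congr1 (mulmx (invmx M))); rewrite mulKmx// mulmx0 => /colP/(_ i).
  by rewrite !mxE.
move=> i x; have [+ _] := ode_unique dPQ.1 d0 d'0 i x.
by rewrite dE => /eqP; rewrite subr_eq0 => /eqP.
Qed.

End System.

(** * Weak and classical solutions *)

Section WeakSystem.
Variables (R : realType) (n : nat) (A : R -> 'M[R]_n) (B : R).
Local Notation mu := (@lebesgue_measure R).
Hypothesis A_cont : forall i j, continuous (fun x => A x i j).
Hypothesis A_bound : forall x i j, `|A x i j| <= B.
Implicit Types (p q r s : 'I_n -> R -> R).

Definition weak_sol p := (forall i, inH1 (p i)) /\
  (forall i psi, test_function psi ->
     \int[mu]_x (- (p i x * derive1n 2 psi x) + rhs A p i x * psi x) = 0).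

Lemma rhs_L2 p i : (forall i, L2 (p i)) -> L2 (rhs A p i).
Proof.
move=> lp; apply: L2_sum => l.
have := L2_mulb (lp l) (continuous_measurable_fun (@A_cont i l)) (fun x => A_bound x i l).
by congr L2; apply/funext => x; rewrite mulrC.
Qed.

Lemma rhs_continuous p i : (forall i, continuous (p i)) -> continuous (rhs A p i).
Proof.
move=> cp x; apply: cvg_sumf => l; apply: cvgM; [exact: A_cont|exact: cp].
Qed.

Lemma Rintegral_by_parts (p q psi : R -> R) : continuous q -> 
  (forall x : R, is_derive x 1 p (q x)) -> test_function psi ->
  \int[mu]_x (p x * derive1 psi x) = - \int[mu]_x (q x * psi x).
Proof.
move=> cq dp tpsi; have cp := continuous_is_derive dp.
have cpsi := test_continuous (n := 0) tpsi.
have cpsi' := test_continuous (n := 1) tpsi.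
have [_ [M psiM]] := tpsi.
have dF (x : R) : is_derive x 1 (fun t => p t * psi t) (q x * psi x + p x * derive1 psi x).
  apply: is_deriveMf => //; exact: (test_is_derive 0 x tpsi).
have cF : continuous (fun x => q x * psi x + p x * derive1 psi x).
  by move=> x; apply: cvgD; apply: cvgM; [exact: cq|exact: cpsi|exact: cp|exact: cpsi'].
have := @Rintegral_derive_supp _ _ _ (- (`|M| + 1)) (`|M| + 1) cF dF _.
rewrite RintegralD//; last 2 first.
- by apply: test_integrable => //; exact: continuous_locint.
- by apply: test_integrable; [exact: continuous_locint|exact: test_derive1].
move=> h; apply/eqP; rewrite -addr_eq0 addrC; apply/eqP; apply: h => x.
rewrite -ltr_norml -leNgt => xM; rewrite psiM ?mulr0//.
by apply: lt_le_trans xM; rewrite (le_lt_trans (ler_norm M))// ltrDl.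
Qed.

Lemma L2_sol_weak p q : L2_sol A p q -> weak_sol p.
Proof.
move=> [[dp dq] [lp lq]].
have cp i := continuous_is_derive (dp i); have cq i := continuous_is_derive (dq i).
split=> [i|i psi tpsi].
  split; first exact/Lfun2P.
  by exists (q i); [exact/Lfun2P|move=> psi; exact: Rintegral_by_parts].
have crhs := rhs_continuous (i := i) cp.
have h1 := Rintegral_by_parts (cq i) (dp i) (test_derive1 tpsi).
have h2 := Rintegral_by_parts crhs (dq i) tpsi.
under eq_Rintegral do rewrite addrC.
rewrite RintegralB//; last 2 first.
- by apply: test_integrable => //; exact: continuous_locint.
- by apply: test_integrable; [exact: L2_locint|exact: (test_derive1n 2)].
by rewrite /= h1 h2 opprK subrr.
Qed.

(** The tested equation says that [A p] is the weak derivative of the weak derivative [g] of [p], so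
    [weak_derivative_ac] applies twice. Under the integrals, [g] and [p] may be replaced by their
    continuous representatives, and this makes the primitives differentiable. *)
Lemma weak_sol_classical p : weak_sol p ->
  exists P Q, L2_sol A P Q /\ forall i, {ae mu, forall x, p i x = P i x}.
Proof.
move=> [Hp wp].
have lp i : L2 (p i) by apply/Lfun2P; exact: (Hp i).1.
pose g i := s2val (cid2 (Hp i).2).
have lg i : L2 (g i) by apply/Lfun2P; exact: (s2valP (cid2 (Hp i).2)).
have wg i : weak_derivative (p i) (g i) by exact: (s2valP' (cid2 (Hp i).2)).
have lr i : L2 (rhs A p i) by exact: rhs_L2.
have wr i : weak_derivative (g i) (rhs A p i).
  move=> psi tpsi; have := wp i psi tpsi.
  have -> : \int[mu]_x (- (p i x * derive1n 2 psi x) + rhs A p i x * psi x) =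
    \int[mu]_x (rhs A p i x * psi x) - \int[mu]_x (p i x * derive1n 2 psi x).
    under eq_Rintegral do rewrite addrC.
    rewrite RintegralB//.
    + by apply: test_integrable => //; exact: L2_locint.
    + by apply: test_integrable; [exact: L2_locint|exact: (test_derive1n 2)].
  rewrite /= (wg i _ (test_derive1 tpsi)) opprK => /eqP.
  by rewrite addrC addr_eq0 => /eqP.
have exP i := cid (weak_derivative_ac (lp i).1 (L2_locint (lp i)) (L2_locint (lg i)) (wg i)).
have exQ i := cid (weak_derivative_ac (lg i).1 (L2_locint (lg i)) (L2_locint (lr i)) (wr i)).
pose P i := sval (exP i); pose Q i := sval (exQ i).
have cP i : continuous (P i) by case: (svalP (exP i)).
have aP i : {ae mu, forall x, p i x = P i x} by case: (svalP (exP i)).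
have iP i a b : a <= b -> P i b - P i a = \int[mu]_(x in `[a, b]) g i x.
  by move=> ab; case: (svalP (exP i)) => _ _; exact.
have cQ i : continuous (Q i) by case: (svalP (exQ i)).
have aQ i : {ae mu, forall x, g i x = Q i x} by case: (svalP (exQ i)).
have iQ i a b : a <= b -> Q i b - Q i a = \int[mu]_(x in `[a, b]) rhs A p i x.
  by move=> ab; case: (svalP (exQ i)) => _ _; exact.
have ar i : {ae mu, forall x, rhs A p i x = rhs A P i x}.
  have FF := ae_filter_ringOfSetsType mu.
  have : {ae mu, forall x, forall l, p l x = P l x} by apply: filter_forall => l; exact: aP.
  by apply: filterS => x pP; apply: eq_bigr => l _; rewrite pP.
exists P, Q; split; last exact: aP.
split; split=> i.
- apply: is_derive_incr => // a b ab; rewrite iP//; apply: ae_Rintegral => //.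
  + exact: (lg i).1.
  + exact: continuous_measurable_fun.
- apply: is_derive_incr => [|a b ab]; first exact: rhs_continuous.
  rewrite iQ//; apply: ae_Rintegral => //; first exact: (lr i).1.
  by apply: continuous_measurable_fun; exact: rhs_continuous.
- exact: (L2_ae (lp i) (continuous_measurable_fun (cP i)) (aP i)).
- exact: (L2_ae (lg i) (continuous_measurable_fun (cQ i)) (aQ i)).
Qed.

End WeakSystem.

(** * Decay of the flow *)

Section BoundedContinuous.
Variable R : realType.
Local Notation mu := (@lebesgue_measure R).
Implicit Types (f g : R -> R).

(** These functions form an algebra that multiplies [L2] into itself; every term of the fields below
    is such a factor times [psi]. *)
Definition bcont f := continuous f /\ exists C, forall x, `|f x| <= C.

Lemma bcont_cst (c : R) : bcont (fun=> c).
Proof. by split; [exact: cst_continuous|exists `|c|]. Qed.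

Lemma bcontD f g : bcont f -> bcont g -> bcont (fun x => f x + g x).
Proof.
move=> [cf [C fC]] [cg [D gD]]; split; first by move=> x; apply: cvgD; [exact: cf|exact: cg].
by exists (C + D) => x; rewrite (le_trans (ler_normD _ _))// lerD.
Qed.

Lemma bcontM f g : bcont f -> bcont g -> bcont (fun x => f x * g x).
Proof.
move=> [cf [C fC]] [cg [D gD]]; split; first by move=> x; apply: cvgM; [exact: cf|exact: cg].
by exists (C * D) => x; rewrite normrM ler_pM.
Qed.

Lemma bcont_sum n (F : 'I_n -> R -> R) : (forall i, bcont (F i)) -> bcont (fun x => \sum_i F i x).
Proof.
elim: n F => [|n IH] F bF.
  rewrite (_ : (fun _ => _) = fun=> 0); first exact: bcont_cst.
  by apply/funext => x; rewrite big_ord0.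
rewrite (_ : (fun _ => _) = fun x => F ord0 x + \sum_(i < n) F (lift ord0 i) x).
  by apply: bcontD => //; apply: IH.
by apply/funext => x; rewrite big_ord_recl.
Qed.

Lemma L2_bcont f g : bcont f -> L2 g -> L2 (fun x => f x * g x).
Proof.
move=> [cf [C fC]] lg; have := L2_mulb lg (continuous_measurable_fun cf) fC.
by congr L2; apply/funext => x; rewrite mulrC.
Qed.

Definition mbcont m n (A : R -> 'M[R]_(m, n)) := forall i j, bcont (fun x => A x i j).
Definition mL2 m n (A : R -> 'M[R]_(m, n)) := forall i j, L2 (fun x => A x i j).

Lemma mbcont_cst m n (A : 'M[R]_(m, n)) : mbcont (fun=> A).
Proof. by move=> i j; exact: bcont_cst. Qed.

Lemma mbcont_tr m n (A : R -> 'M[R]_(m, n)) : mbcont A -> mbcont (fun x => (A x)^T).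
Proof.
move=> bA i j; rewrite (_ : (fun x => _) = fun x => A x j i) //.
by apply/funext => x; rewrite mxE.
Qed.

Lemma mbcontM m n p (A : R -> 'M[R]_(m, n)) (B : R -> 'M[R]_(n, p)) :
  mbcont A -> mbcont B -> mbcont (fun x => A x *m B x).
Proof.
move=> bA bB i j; rewrite (_ : (fun x => _) = fun x => \sum_l A x i l * B x l j).
  by apply: bcont_sum => l; exact: bcontM.
by apply/funext => x; rewrite mxE.
Qed.

Lemma mL2M m n p (A : R -> 'M[R]_(m, n)) (B : R -> 'M[R]_(n, p)) :
  mbcont A -> mL2 B -> mL2 (fun x => A x *m B x).
Proof.
move=> bA lB i j; rewrite (_ : (fun x => _) = fun x => \sum_l A x i l * B x l j).
  by apply: L2_sum => l; exact: L2_bcont.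
by apply/funext => x; rewrite mxE.
Qed.

Lemma mL2D m n (A B : R -> 'M[R]_(m, n)) : mL2 A -> mL2 B -> mL2 (fun x => A x + B x).
Proof.
move=> bA lB i j; rewrite (_ : (fun x => _) = fun x => A x i j + B x i j); first exact: L2D.
by apply/funext => x; rewrite mxE.
Qed.

Lemma mL2Z m n c (A : R -> 'M[R]_(m, n)) : mL2 A -> mL2 (fun x => c *: A x).
Proof.
move=> bA i j; rewrite (_ : (fun x => _) = fun x => c * A x i j); first exact: L2Z.
by apply/funext => x; rewrite mxE.
Qed.

End BoundedContinuous.

Section FlowL2.
Variables (R : realType) (K : nat) (h : 'I_K -> R).
Hypothesis h_gt0 : forall b, 0 < h b.
Variable v : R -> 'cV[R]_K.
Hypothesis dv : forall x, mderiv v x (dmx h *m v x).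
Local Notation Q := (Qmx h).
Local Notation q x := (psi h (v x)).

Lemma bcont_Qmx : mbcont (fun x => Q (v x)).
Proof.
move=> i j; split; last by exists (flow_bound h) => x; exact: Qmx_le.
by apply: continuous_is_derive => x; exact: mderiv_Qmx_x.
Qed.

Lemma bcont_psi : mbcont (fun x => q x).
Proof.
move=> i j; rewrite ord1; split; last by exists (flow_bound h) => x; exact: psi_le.
by apply: continuous_is_derive => x; exact: mderiv_psi_x.
Qed.

(* [2 psi_i ^ 2 = - (Q_ii)'] and [Q_ii] is bounded. *)
Lemma L2_psi : mL2 (fun x => q x).
Proof.
move=> i j; rewrite ord1; have [cp _] := bcont_psi i 0.
split; first exact: continuous_measurable_fun.
have cp2 : continuous (fun x => 2 * q x i 0 ^+ 2).
  by move=> x; apply: cvgM; [exact: cvg_cst|apply: cvgM; exact: cp].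
have dQ (x : R) : is_derive x 1 (fun t => - Q (v t) i i) (2 * q x i 0 ^+ 2).
  have := is_deriveNf (mderiv_Qmx_x h_gt0 dv x i i).
  by rewrite mxZE outerE mulNr opprK -expr2.
have := integrable_derive_bounded cp2 (fun x => _) dQ (fun x => _).
move=> /(_ (flow_bound h)) I2; apply: (@integrable_le _ _ _ (fun x => 2 * q x i 0 ^+ 2)) => //.
- by apply: measurable_funX; exact: continuous_measurable_fun.
- by move=> x _; rewrite ger0_norm ?sqr_ge0//; have := sqr_ge0 (q x i 0); lra.
- apply: I2 => x; first by rewrite mulr_ge0 ?sqr_ge0.
  by rewrite normrN; exact: Qmx_le.
Qed.

Lemma L2_psi' : mL2 (fun x => Q (v x) *m dmx h *m q x).
Proof.
apply: mL2M; last exact: L2_psi.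
by apply: mbcontM; [exact: bcont_Qmx|exact: mbcont_cst].
Qed.

Lemma L2_tang e : mL2 (tang h v e).
Proof.
apply: mL2M; last exact: L2_psi.
by apply: mbcontM; [exact: bcont_Qmx|exact: mbcont_cst].
Qed.

Lemma L2_tang' e : mL2 (tang' h v e).
Proof.
have bQ := bcont_Qmx; have bp := bcont_psi; have lp := L2_psi.
apply: mL2D; first apply: mL2Z; apply: mL2M => //.
  apply: mbcontM; last exact: mbcont_cst.
  by apply: mbcontM => //; exact: mbcont_tr.
do ![exact: mbcont_cst | exact: bQ | apply: mbcontM].
Qed.

Lemma outer3E (u w z : 'cV[R]_K) l i :
  (u *m w^T *m dmx l *m z) i 0 = u i 0 * \sum_b l b * w b 0 * z b 0.
Proof.
rewrite -!mulmxA mxE big_ord1 mxE; congr (_ * _).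
by apply: eq_bigr => b _; rewrite mxE mul_dmxE; ring.
Qed.

Lemma psi_odeE (x : R) i :
  is_derive x 1 (fun t => (Q (v t) *m dmx h *m q t) i 0)
    ((h i ^+ 2 - 4 * \sum_b h b * q x b 0 * q x b 0) * q x i 0).
Proof.
have := psi_ode h_gt0 dv x i 0.
have -> : (dmx h *m dmx h *m q x - 4 *: (q x *m (q x)^T *m dmx h *m q x)) i 0 =
  (h i ^+ 2 - 4 * \sum_b h b * q x b 0 * q x b 0) * q x i 0.
  by rewrite mxDE mxNE mxZE outer3E -mulmxA !mul_dmxE; ring.
by [].
Qed.

Lemma tang_odeE e (x : R) i :
  is_derive x 1 (fun t => tang' h v e t i 0)
    ((h i ^+ 2 - 4 * \sum_b h b * q x b 0 * q x b 0) * tang h v e x i 0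
     - 8 * q x i 0 * \sum_b h b * q x b 0 * tang h v e x b 0).
Proof.
have := tang_ode h_gt0 dv e x i 0.
have -> : (dmx h *m dmx h *m tang h v e x
   - 4 *: (tang h v e x *m (q x)^T *m dmx h *m q x)
   - 8 *: (q x *m (q x)^T *m dmx h *m tang h v e x)) i 0 =
    (h i ^+ 2 - 4 * \sum_b h b * q x b 0 * q x b 0) * tang h v e x i 0
     - 8 * q x i 0 * \sum_b h b * q x b 0 * tang h v e x b 0.
  by rewrite !(mxDE, mxNE) !mxZE !outer3E -mulmxA !mul_dmxE; ring.
by [].
Qed.

End FlowL2.

(** * Nondegeneracy near -oo *)

Section SmallV.
Variables (R : realType) (K : nat) (h : 'I_K -> R).
Hypothesis h_gt0 : forall b, 0 < h b.
Local Notation Q := (Qmx h).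

(** In the product [psiE] the second factor is positive, because [flow_bound] bounds every
    [psi_b]. *)
Lemma psi_neq0 (v : 'cV[R]_K) i : v i 0 != 0 ->
  \sum_b `|v b 0| * (flow_bound h / (h i + h b)) < 1 -> psi h v i 0 != 0.
Proof.
move=> vi small; rewrite psiE// mulf_neq0// subr_eq0 eq_sym lt_eqF//.
apply: le_lt_trans small; apply: ler_sum => b _.
have hb : 0 < h i + h b by rewrite addr_gt0.
rewrite -mulrA [_ / _]mulrC [flow_bound h / _]mulrC.
rewrite !mulrA ![_ * (h i + h b)^-1]mulrC -!mulrA ler_pM2l ?invr_gt0//.
by rewrite (le_trans (ler_norm _))// normrM ler_wpM2l// psi_le.
Qed.

(** Multiplication by [1 + M] turns [Q z = 0] into [z = M z]; the hypothesis bounds the column sums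
    of [|M|] by 1/2, so [M] contracts the sum norm. *)
Lemma Qmx_inj (v z : 'cV[R]_K) :
  (forall b, \sum_i `|v i 0| * (`|v b 0| / (h i + h b)) <= 1 / 2) ->
  Q v *m z = 0 -> z = 0.
Proof.
move=> small Qz.
have zM : z = cauchy h v *m z.
  have : (1%:M + cauchy h v) *m (Q v *m z) = 0 by rewrite Qz mulmx0.
  rewrite mulmxA /Qmx !mulmxBr !mulmxDr mulmxP// mulmx1 !mulmxBl !mulmxDl mul1mx.
  move=> /eqP; rewrite -subr_eq0 => /eqP e; apply/eqP; rewrite -subr_eq0 -[X in _ == X]e subr0.
  by apply/eqP/matrixP => i j; rewrite !mxlinE; ring.
have sum_le : \sum_i `|z i 0| <= 1 / 2 * \sum_i `|z i 0|.
  rewrite [in leLHS]zM mulr_sumr.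
  apply: (@le_trans _ _ (\sum_i \sum_b `|cauchy h v i b| * `|z b 0|)).
    apply: ler_sum => i _; rewrite mxE (le_trans (ler_norm_sum _ _ _))//.
    by apply: ler_sum => b _; rewrite normrM.
  rewrite exchange_big/=; apply: ler_sum => b _; rewrite -mulr_suml ler_wpM2r//.
  apply: le_trans (small b); apply: ler_sum => i _.
  rewrite mxE normrM normrM normfV -mulrA ler_wpM2l// ler_wpM2l//.
  by rewrite gtr0_norm ?addr_gt0.
have s0 : 0 <= \sum_i `|z i 0| by rewrite sumr_ge0.
have /eqP : \sum_i `|z i 0| = 0 by lra.
rewrite psumr_eq0// => /allP z0; apply/colP => i; rewrite mxE; apply/eqP.
by have := z0 i (mem_index_enum _); rewrite normr_eq0.
Qed.

Lemma good_point (v : R -> 'cV[R]_K) :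
  (forall x i, v x i 0 != 0) -> (forall i, v (- t) i 0 @[t --> +oo] --> (0 : R)) ->
  exists x, (forall i, psi h (v x) i 0 != 0) /\ (forall z : 'cV_K, Q (v x) *m z = 0 -> z = 0).
Proof.
move=> vn0 v0.
have vn i : `|v (- t) i 0| @[t --> +oo] --> (0 : R).
  by rewrite -(@normr0 _ R); apply: cvg_norm; exact: v0.
have sum0 : \sum_(i < K) (0 : R) = 0 by rewrite big1.
have c1 i : \sum_b `|v (- t) b 0| * (flow_bound h / (h i + h b)) @[t --> +oo] --> (0 : R).
  rewrite -[X in _ --> X]sum0; apply: cvg_sumf => b.
  by rewrite -[X in _ --> X](mul0r (flow_bound h / (h i + h b))); apply: cvgMl; exact: vn.
have c2 b : \sum_i `|v (- t) i 0| * (`|v (- t) b 0| / (h i + h b)) @[t --> +oo] --> (0 : R).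
  rewrite -[X in _ --> X]sum0; apply: cvg_sumf => i.
  rewrite -[X in _ --> X](mul0r (0 / (h i + h b))); apply: cvgM; first exact: vn.
  by apply: cvgMl; exact: vn.
have n1 : \forall t \near +oo, forall i, \sum_b `|v (- t) b 0| * (flow_bound h / (h i + h b)) < 1.
  by apply: filter_forall => i; apply: cvgr_lt (c1 i) _ _; exact: ltr01.
have n2 : \forall t \near +oo, forall b, \sum_i `|v (- t) i 0| * (`|v (- t) b 0| / (h i + h b)) <= 1 / 2.
  by apply: filter_forall => i; apply: cvgr_le (c2 i) _ _; lra.
have [t [h1 h2]] := filter_ex (filterI n1 n2).
exists (- t); split => [i|z]; first exact: psi_neq0.
exact: Qmx_inj.
Qed.

End SmallV.

(** * The soliton family *)

Section Family.
Variables (R : realType) (K : nat) (mu_ : 'I_K -> R).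
Hypothesis mu_lt0 : forall al, mu_ al < 0.
Local Notation h := (eta mu_).
Local Notation Q := (Qmx h).

Lemma eta_gt0 al : 0 < h al.
Proof. by rewrite sqrtr_gt0 oppr_gt0. Qed.

Lemma eta_sqr al : h al ^+ 2 = - mu_ al.
Proof. by rewrite sqr_sqrtr// oppr_ge0 ltW. Qed.

(** The factor between [psi] and [V]; [amp b * amp c] is also the denominator [2 sqrt (h_b h_c)] in
    [Mmx]. *)
Definition amp al : R := Num.sqrt (2 * h al).

Lemma amp_gt0 al : 0 < amp al.
Proof. by rewrite sqrtr_gt0 mulr_gt0 ?eta_gt0. Qed.

Lemma amp_sqr al : amp al ^+ 2 = 2 * h al.
Proof. by rewrite sqr_sqrtr// mulr_ge0 ?ltW ?eta_gt0. Qed.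

Definition vvec (a : 'I_K -> R) x : 'cV[R]_K := \col_b (a b * expR (h b * x) / amp b).

Lemma Mmx_cauchy a x : Mmx mu_ a x = cauchy h (vvec a x).
Proof.
apply/matrixP => b c; rewrite !mxE.
have -> : 2 * Num.sqrt (h b * h c) = amp b * amp c.
  have key (y z : R) : 0 <= y -> 0 <= z ->
      2 * Num.sqrt (y * z) = Num.sqrt (2 * y) * Num.sqrt (2 * z).
    move=> y0 z0; rewrite -sqrtrM ?mulr_ge0// (_ : 2 * y * _ = 2 ^+ 2 * (y * z)); last by ring.
    by rewrite [RHS]sqrtrM ?exprn_ge0// sqrtr_sqr ger0_norm.
  by apply: key; rewrite ltW ?eta_gt0.
rewrite mulrDl expRD; field.
by rewrite !gt_eqF ?amp_gt0 ?addr_gt0 ?eta_gt0.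
Qed.

Lemma V_psi a al x : V mu_ a al x = amp al * psi h (vvec a x) al 0.
Proof.
have vE : a al * expR (h al * x) = amp al * vvec a x al 0.
  by rewrite mxE; field; rewrite gt_eqF ?amp_gt0.
by rewrite -(det_psi eta_gt0) /V Mmx_cauchy vE !mulrA.
Qed.

Lemma vvec_flow a x : mderiv (vvec a) x (dmx h *m vvec a x).
Proof.
move=> b j; rewrite ord1 mul_dmxE mxE.
rewrite (_ : (fun t => _) = fun t => a b / amp b * expR (h b * t)); last first.
  by apply/funext => t; rewrite mxE; ring.
have dh : is_derive x 1 (fun t => h b * t) (h b).
  by have := is_deriveZf (h b) (is_derive_id x 1); rewrite mulr1.
have := is_deriveZf (a b / amp b) (@is_derive1_comp _ expR (fun t => h b * t) x _ _ (is_derive_expR _) dh).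
have -> : a b / amp b * (expR (h b * x) * h b) = h b * (a b * expR (h b * x) / amp b) by ring.
by [].
Qed.

(* [vvec a x] moves with velocity [dmx (param_rate a ga) *m vvec a x] in the
   direction of the parameter [a ga]. *)
Definition param_rate (a : 'I_K -> R) ga b : R := if b == ga then (a ga)^-1 else 0.

Lemma vvec_param a ga x : a ga != 0 ->
  mderiv (fun t => vvec [eta a with ga |-> t] x) (a ga) (dmx (param_rate a ga) *m vvec a x).
Proof.
move=> a0 b j; rewrite ord1 mul_dmxE mxE /param_rate.
have [->|bg] := eqVneq b ga.
  rewrite (_ : (fun t => _) = fun t => expR (h ga * x) / amp ga * t); last first.
    by apply/funext => t; rewrite mxE /= eqxx; ring.
  have := is_deriveZf (expR (h ga * x) / amp ga) (is_derive_id (a ga) 1).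
  have -> : expR (h ga * x) / amp ga * 1 = (a ga)^-1 * (a ga * expR (h ga * x) / amp ga).
    by field; rewrite a0 gt_eqF ?amp_gt0.
  by [].
rewrite (_ : (fun t => _) = fun t => a b * expR (h b * x) / amp b); last first.
  by apply/funext => t; rewrite mxE /= (negbTE bg).
by rewrite mul0r; exact: is_derive_cst.
Qed.

(** The updated parameter function at [t = a ga] is not convertible to [a]; the derivative rules
    first produce it in this form. *)
Lemma vvec_id a ga x : vvec [eta a with ga |-> a ga] x = vvec a x.
Proof. by apply/colP => b; rewrite !mxE /=; case: eqP => [->|]. Qed.

Lemma V_param a ga al x : a ga != 0 ->
  derive1 (fun t : R => V mu_ [eta a with ga |-> t] al x) (a ga) =
  amp al * tang h (vvec a) (param_rate a ga) x al 0.
Proof.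
move=> a0.
have d0 : mderiv (fun t => vvec [eta a with ga |-> t] x) (a ga)
   (dmx (param_rate a ga) *m vvec [eta a with ga |-> a ga] x).
  by rewrite vvec_id; exact: vvec_param.
have := is_deriveZf (amp al) (mderiv_psi eta_gt0 d0 al 0).
rewrite vvec_id -/(tang h (vvec a) (param_rate a ga) x) => D.
rewrite derive1E (_ : (fun t => V _ _ _ _) = fun t => amp al * psi h (vvec [eta a with ga |-> t] x) al 0).
  by have [_ ->] := D.
by apply/funext => t; rewrite V_psi.
Qed.

Lemma vvec_neq0 a x b : a b != 0 -> vvec a x b 0 != 0.
Proof.
move=> a0; rewrite mxE; apply: mulf_neq0; first by rewrite mulf_neq0 ?(gt_eqF (expR_gt0 _)).
by rewrite invr_neq0 ?gt_eqF ?amp_gt0.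
Qed.

Lemma vvec_cvg0 a b : vvec a (- t) b 0 @[t --> +oo] --> (0 : R).
Proof.
have e0 : a b / amp b * expR (- (h b * t)) @[t --> +oo] --> a b / amp b * 0.
  apply: cvgMr.
  apply: (@cvg_comp _ _ _ (fun t => h b * t) (fun t => expR (- t)) _ (+oo)%R) => /=.
    by apply: gt0_cvgMry; [exact: eta_gt0|exact: cvg_id].
  exact: cvgr_expR.
rewrite mulr0 in e0.
have : (fun t => vvec a (- t) b 0) = fun t => a b / amp b * expR (- (h b * t)).
  by apply/funext => t; rewrite mxE mulrN; ring.
by move=> ->.
Qed.

End Family.

(** * Tangent fields as solutions of the linearized system *)

Section Extended.
Variables (R : realType) (K : nat) (k : 'I_K -> nat) (mu_ : 'I_K -> R).
Local Notation N := (\sum_(al < K) k al)%N.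
Hypothesis mu_lt0 : forall al, mu_ al < 0.
Variables (a : 'I_K -> R) (n : 'I_N -> R).
Hypothesis a_neq0 : forall al, a al != 0.
Hypothesis n_unit : unit_blocks n.
Local Notation h := (eta mu_).
Local Notation v := (vvec mu_ a).
Local Notation q x := (psi h (v x)).
Local Notation U := (U mu_ a n).
Local Notation bl := (@block K k).

Let h_gt0 := eta_gt0 mu_lt0.
Let dv x := @vvec_flow R K mu_ a x.

Lemma block_sum (c : 'I_N -> R) (F : 'I_K -> R) :
  \sum_l c l * F (bl l) = \sum_al F al * \sum_(l | bl l == al) c l.
Proof.
rewrite (partition_big bl predT)//=; apply: eq_bigr => al _.
by rewrite mulr_sumr; apply: eq_bigr => l /eqP ->; rewrite mulrC.
Qed.

Lemma block_sum_unit (F : 'I_K -> R) : \sum_l n l ^+ 2 * F (bl l) = \sum_al F al.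
Proof. by rewrite block_sum; apply: eq_bigr => al _; rewrite n_unit mulr1. Qed.

(** The symmetric matrix with which the kernel equation reads [phi'' = coef phi]. *)
Definition coef x : 'M[R]_N := \matrix_(i, l)
  ((- nu mu_ i - 2 * \sum_(j < N) U j x ^+ 2) *+ (i == l) - 4 * U i x * U l x).

Lemma rhs_coef (p : 'I_N -> R -> R) i x : rhs coef p i x =
  (- nu mu_ i - 2 * \sum_(j < N) U j x ^+ 2) * p i x
  - 4 * U i x * \sum_l U l x * p l x.
Proof.
rewrite /rhs (eq_bigr (fun l => (- nu mu_ i - 2 * \sum_(j < N) U j x ^+ 2) *+ (i == l) * p l x
    - 4 * U i x * (U l x * p l x))).
  rewrite sumrB -mulr_sumr; congr (_ - _).
  rewrite (bigD1 i)//= eqxx mulr1n addrC big1 ?add0r// => l li.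
  by rewrite eq_sym (negbTE li) mulr0n mul0r.
by move=> l _; rewrite mxE mulrBl; ring.
Qed.

Lemma bcont_U i : bcont (U i).
Proof.
rewrite (_ : U i = fun x => n i * amp mu_ (bl i) * q x (bl i) 0).
  by apply: bcontM; [exact: bcont_cst|exact: (bcont_psi h_gt0 dv)].
by apply/funext => x; rewrite /Defs.U V_psi// mulrA.
Qed.

Lemma bcont_coef : mbcont coef.
Proof.
move=> i l; rewrite (_ : (fun x => _) = fun x =>
  (- nu mu_ i + (- 2) * \sum_(j < N) U j x * U j x) * (i == l)%:R + (- 4) * (U i x * U l x)).
  apply: bcontD; last first.
    by apply: bcontM; [exact: bcont_cst|apply: bcontM; exact: bcont_U].
  apply: bcontM; last exact: bcont_cst.
  apply: bcontD; first exact: bcont_cst.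
  apply: bcontM; first exact: bcont_cst.
  by apply: bcont_sum => j; apply: bcontM; exact: bcont_U.
apply/funext => x; rewrite mxE -mulr_natr.
have -> : \sum_(j < N) U j x ^+ 2 = \sum_(j < N) U j x * U j x.
  by apply: eq_bigr => j _; rewrite expr2.
by move: (\sum_j _) => s; ring.
Qed.

Lemma coef_sym x : (coef x)^T = coef x.
Proof.
apply/matrixP => i l; rewrite !mxE eq_sym; case: eqP => [->|_] //.
by rewrite !mulr0n; ring.
Qed.

Lemma coef_cont i l : continuous (fun x => coef x i l).
Proof. by have [] := bcont_coef i l. Qed.

Lemma coef_bound : exists B, forall x i l, `|coef x i l| <= B.
Proof.
pose c i l := sval (cid (bcont_coef i l).2).
have cP i l x : `|coef x i l| <= c i l by exact: (svalP (cid (bcont_coef i l).2)).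
exists (\sum_i \sum_l `|c i l|) => x i l.
rewrite (le_trans (cP i l x))// (bigD1 i)//= (bigD1 l)//= -addrA.
apply: (le_trans (ler_norm _)); rewrite lerDl addr_ge0 ?sumr_ge0// => j _.
by rewrite sumr_ge0.
Qed.

(** The scalar [psi^T H psi], half of the density [S]. *)
Definition amp_sum x := \sum_b h b * q x b 0 * q x b 0.

Lemma sum_U_sqr x : \sum_(j < N) U j x ^+ 2 = 2 * amp_sum x.
Proof.
rewrite (eq_bigr (fun j => n j ^+ 2 * (2 * (h (bl j) * q x (bl j) 0 * q x (bl j) 0)))).
  by rewrite (block_sum_unit (fun al => 2 * (h al * q x al 0 * q x al 0))) -mulr_sumr.
move=> j _; rewrite /Defs.U V_psi// !exprMn amp_sqr//; ring.
Qed.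

Lemma sum_U_mul x (w : 'cV[R]_K) (c : 'I_N -> R) :
  \sum_l U l x * (c l * w (bl l) 0) =
  \sum_al V mu_ a al x * w al 0 * \sum_(l | bl l == al) n l * c l.
Proof.
rewrite -(block_sum (fun l => n l * c l) (fun al => V mu_ a al x * w al 0)).
by apply: eq_bigr => l _; rewrite /Defs.U; ring.
Qed.

(** Common scheme for both kinds of tangent fields. The term [z] stands for the coupling
    [4 U (U . phi)]: zero for rotations inside the blocks, present for parameter derivatives. *)
Lemma L2_sol_scaled (c : 'I_N -> R) (w w' : R -> 'cV[R]_K) (z : 'I_K -> R -> R) :
  mL2 w -> mL2 w' -> (forall x, mderiv w x (w' x)) ->
  (forall (x : R) al, is_derive x 1 (fun t => w' t al 0)
     ((h al ^+ 2 - 4 * amp_sum x) * w x al 0 - z al x)) ->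
  (forall i x, 4 * U i x * (\sum_l U l x * (c l * w x (bl l) 0)) = c i * z (bl i) x) ->
  L2_sol coef (fun i x => c i * w x (bl i) 0) (fun i x => c i * w' x (bl i) 0).
Proof.
move=> lw lw' dw dw' cz; split; last by split=> i; apply: L2Z.
split=> i x; first by apply: is_deriveZf; exact: dw.
have := is_deriveZf (c i) (dw' x (bl i)).
have -> : c i * ((h (bl i) ^+ 2 - 4 * amp_sum x) * w x (bl i) 0 - z (bl i) x) =
   rhs coef (fun i x => c i * w x (bl i) 0) i x.
  by rewrite rhs_coef cz sum_U_sqr eta_sqr// /nu; ring.
by [].
Qed.

Definition block_orth (c : 'I_N -> R) := forall al, \sum_(l | bl l == al) n l * c l = 0.

Lemma mL2_amp (w : R -> 'cV[R]_K) : mL2 w -> mL2 (fun x => dmx (amp mu_) *m w x).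
Proof. by move=> lw; apply: mL2M => //; exact: mbcont_cst. Qed.

Lemma mderiv_amp (w : R -> 'cV[R]_K) w' x : mderiv w x w' ->
  mderiv (fun t => dmx (amp mu_) *m w t) x (dmx (amp mu_) *m w').
Proof.
move=> dw; have := mderivM (@mderiv_cst _ _ _ (dmx (amp mu_)) x) dw.
by rewrite mul0mx add0r.
Qed.

(** Orthogonality to [n] in each block kills the coupling, and what remains is the equation of [V]
    itself. *)
Lemma L2_sol_V (c : 'I_N -> R) : block_orth c ->
  exists Q, L2_sol coef (fun i x => c i * V mu_ a (bl i) x) Q.
Proof.
move=> cn; pose w x := dmx (amp mu_) *m q x.
pose w' x := dmx (amp mu_) *m (Qmx h (v x) *m dmx h *m q x).
exists (fun i x => c i * w' x (bl i) 0).
rewrite (_ : (fun i x => c i * V mu_ a (bl i) x) = fun i x => c i * w x (bl i) 0); last first.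
  by apply/funext => i; apply/funext => x; rewrite V_psi// mul_dmxE.
apply: (@L2_sol_scaled c w w' (fun _ _ => 0)).
- by apply: mL2_amp; exact: (L2_psi h_gt0 dv).
- by apply: mL2_amp; exact: (L2_psi' h_gt0 dv).
- by move=> x; apply: mderiv_amp; exact: (mderiv_psi_x h_gt0 dv).
- move=> x al; rewrite (_ : (fun t => _) = fun t => amp mu_ al * (Qmx h (v t) *m dmx h *m q t) al 0).
    have := is_deriveZf (amp mu_ al) (psi_odeE h_gt0 dv x al).
    have -> : amp mu_ al * ((h al ^+ 2 - 4 * \sum_b h b * q x b 0 * q x b 0) * q x al 0) =
      (h al ^+ 2 - 4 * amp_sum x) * w x al 0 - 0.
      by rewrite /w mul_dmxE /amp_sum; ring.
    by [].
  by apply/funext => t; rewrite mul_dmxE.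
- move=> i x; rewrite sum_U_mul mulr0 big1 ?mulr0// => al _; by rewrite cn mulr0.
Qed.

Lemma Phi_E ga i x : Phi mu_ a n ga i x =
  n i * (amp mu_ (bl i) * tang h v (param_rate a ga) x (bl i) 0).
Proof. by rewrite /Phi V_param. Qed.

Lemma L2_sol_Phi ga : exists Q, L2_sol coef (Phi mu_ a n ga) Q.
Proof.
pose e := param_rate a ga; pose w x := dmx (amp mu_) *m tang h v e x.
pose w' x := dmx (amp mu_) *m tang' h v e x.
exists (fun i x => n i * w' x (bl i) 0).
rewrite (_ : Phi mu_ a n ga = fun i x => n i * w x (bl i) 0); last first.
  by apply/funext => i; apply/funext => x; rewrite Phi_E mul_dmxE.
apply: (@L2_sol_scaled n w w'
   (fun al x => 8 * amp mu_ al * q x al 0 * \sum_b h b * q x b 0 * tang h v e x b 0)).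
- by apply: mL2_amp; exact: (L2_tang h_gt0 dv).
- by apply: mL2_amp; exact: (L2_tang' h_gt0 dv).
- by move=> x; apply: mderiv_amp; exact: (mderiv_tang h_gt0 dv).
- move=> x al; rewrite (_ : (fun t => _) = fun t => amp mu_ al * tang' h v e t al 0).
    have := is_deriveZf (amp mu_ al) (tang_odeE h_gt0 dv e x al).
    set s := \sum_b _; set s' := \sum_b _.
    have -> : amp mu_ al * ((h al ^+ 2 - 4 * s) * tang h v e x al 0 - 8 * q x al 0 * s') =
      (h al ^+ 2 - 4 * amp_sum x) * w x al 0 - 8 * amp mu_ al * q x al 0 * s'.
      by rewrite /w mul_dmxE /amp_sum -/s; ring.
    by [].
  by apply/funext => t; rewrite mul_dmxE.
(* Unit length of [n] on the blocks and [amp ^ 2 = 2 h] turn the coefficient 4 into the 8 of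
   [tang_odeE]. *)
- move=> i x; rewrite sum_U_mul.
  rewrite (eq_bigr (fun al => 2 * (h al * q x al 0 * tang h v e x al 0))).
    by rewrite -mulr_sumr /Defs.U V_psi//; ring.
  move=> al _; rewrite (eq_bigr (fun l => n l ^+ 2)) ?n_unit ?mulr1 => [|l _]; last by rewrite expr2.
  by rewrite V_psi// /w mul_dmxE mulrCA !mulrA -expr2 amp_sqr//; ring.
Qed.

End Extended.

(** * Spans of almost everywhere classes *)

Section Classes.
Variable R : realType.
Local Notation mu := (@lebesgue_measure R).

Definition tclass n (p : 'I_n -> R -> R) : 'I_n -> aefun R := fun i => aeclass (p i).

Lemma aeclass0 : aeclass (fun=> 0 : R) = 0.
Proof. by rewrite -(scale0r (aeclass (fun=> 0 : R))) -aeclassZ; congr aeclass; apply/funext => x; rewrite scale0r. Qed.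

Lemma tclass_lin n m (c : 'I_m -> R) (P : 'I_m -> 'I_n -> R -> R) :
  tclass (fun i x => \sum_j c j * P j i x) = \sum_j c j *: tclass (P j).
Proof.
elim: m c P => [|m IH] c P.
  rewrite big_ord0; apply/funext => i; rewrite /tclass -[RHS]aeclass0; congr aeclass.
  by apply/funext => x; rewrite big_ord0.
rewrite big_ord_recl -IH; apply/funext => i.
rewrite -[RHS]/(c ord0 *: aeclass (P ord0 i)
  + aeclass (fun x => \sum_j c (lift ord0 j) * P (lift ord0 j) i x)) -aeclassZ -aeclassD.
by congr aeclass; apply/funext => x; rewrite big_ord_recl.
Qed.

Lemma lspan_sub (V : lmodType R) (G H : set V) : G `<=` H -> lspan G `<=` lspan H.
Proof. by move=> GH v [d [c [g [Gg ->]]]]; exists d, c, g; split => // j; exact: GH. Qed.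

Lemma lspan_L2_sol n (A : R -> 'M[R]_n) (G : set ('I_n -> aefun R)) :
  G `<=` [set u | exists p q, L2_sol A p q /\ u = tclass p] ->
  lspan G `<=` [set u | exists p q, L2_sol A p q /\ u = tclass p].
Proof.
move=> GS u [d [c [g [Gg ->]]]].
pose p j := sval (cid (GS _ (Gg j))).
pose q j := sval (cid (svalP (cid (GS _ (Gg j))))).
have pq j : L2_sol A (p j) (q j) /\ g j = tclass (p j).
  exact: (svalP (cid (svalP (cid (GS _ (Gg j)))))).
exists (fun i x => \sum_j c j * p j i x), (fun i x => \sum_j c j * q j i x); split.
  by apply: L2_sol_lin => j; have [] := pq j.
by rewrite tclass_lin; apply: eq_bigr => j _; have [_ ->] := pq j.
Qed.

End Classes.

(** * A basis of the tangent space and of the kernel *)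

Section Main.
Variables (R : realType) (K : nat) (k : 'I_K -> nat) (mu_ : 'I_K -> R).
Local Notation N := (\sum_(al < K) k al)%N.
Hypothesis mu_lt0 : forall al, mu_ al < 0.
Variables (a : 'I_K -> R) (n : 'I_N -> R).
Hypothesis a_neq0 : forall al, a al != 0.
Hypothesis n_unit : unit_blocks n.
Local Notation h := (eta mu_).
Local Notation v := (vvec mu_ a).
Local Notation bl := (@block K k).
Local Notation coef := (coef mu_ a n).
Local Notation solset := [set u | exists p q, L2_sol coef p q /\ u = tclass p].

Let h_gt0 := eta_gt0 mu_lt0.

Lemma pivot_ex al : exists i, bl i == al /\ n i != 0.
Proof.
apply: contrapT => nex; have /eqP := n_unit al; rewrite big1 => [|i ial].
  by rewrite eq_sym oner_eq0.
apply/eqP; rewrite sqrf_eq0; apply: contrapT => ni; apply: nex; exists i.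
by split=> //; exact/negP.
Qed.

Definition pivot al : 'I_N := sval (cid (pivot_ex al)).

Lemma block_pivot al : bl (pivot al) = al.
Proof. by apply/eqP; exact: (svalP (cid (pivot_ex al))).1. Qed.

Lemma n_pivot al : n (pivot al) != 0.
Proof. exact: (svalP (cid (pivot_ex al))).2. Qed.

(* [e_j] corrected at the pivot so as to be orthogonal to [n] in the block of [j]. *)
Definition pivot_dir (j i : 'I_N) : R :=
  (i == j)%:R - n j / n (pivot (bl j)) * (i == pivot (bl j))%:R.

(** Each block contributes its parameter derivative at the pivot and one rotation for every other
    index, which makes [N] fields indexed by the components. *)
Definition tangent_basis (j : 'I_N) : 'I_N -> R -> R :=
  if j == pivot (bl j) then Phi mu_ a n (bl j) else Psi mu_ a (bl j) (pivot_dir j).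

Lemma pivot_dir_orth j : \sum_(i < N | bl i == bl j) pivot_dir j i * n i = 0.
Proof.
rewrite (eq_bigr (fun i => (i == j)%:R * n i - n j / n (pivot (bl j)) * ((i == pivot (bl j))%:R * n i))).
  rewrite sumrB -mulr_sumr (bigD1 j)//= eqxx mul1r big1 ?addr0; last first.
    by move=> i /andP[_ /negbTE ->]; rewrite mul0r.
  rewrite (bigD1 (pivot (bl j))) ?block_pivot//= eqxx mul1r big1 ?addr0; last first.
    by move=> i /andP[_ /negbTE ->]; rewrite mul0r.
  by rewrite divfK ?n_pivot// subrr.
by move=> i _; rewrite /pivot_dir; ring.
Qed.

Lemma L2_sol_Psi al c : \sum_(i < N | bl i == al) c i * n i = 0 ->
  exists Q, L2_sol coef (Psi mu_ a al c) Q.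
Proof.
(* [Psi] ignores [c] outside the block; setting it to 0 there gives orthogonality in every block. *)
move=> cn; pose c' i := if bl i == al then c i else 0.
have [Q sQ] : exists Q, L2_sol coef (fun i x => c' i * V mu_ a (bl i) x) Q.
  apply: L2_sol_V => // be; have [->|ba] := eqVneq be al.
    by rewrite -[RHS]cn; apply: eq_bigr => i ial; rewrite /c' ial mulrC.
  by rewrite big1// => i /eqP ib; rewrite /c' ib (negbTE ba) mulr0.
exists Q; move: sQ; congr L2_sol; apply/funext => i; apply/funext => x.
by rewrite /c' /Psi; case: eqP => [->|_]; rewrite ?mul0r.
Qed.

Lemma basis_sol j : exists Q, L2_sol coef (tangent_basis j) Q.
Proof.
rewrite /tangent_basis; case: ifP => _; first exact: L2_sol_Phi.
by apply: L2_sol_Psi; exact: pivot_dir_orth.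
Qed.

Lemma basis_tangent j :
  ([set u | exists ga, u = (fun i => aeclass (Phi mu_ a n ga i))]
         `|` [set u | exists al xi,
                \sum_(i < N | bl i == al) xi i * n i = 0
                /\ u = (fun i => aeclass (Psi mu_ a al xi i))]) (tclass (tangent_basis j)).
Proof.
rewrite /tangent_basis; case: ifP => _; first by left; exists (bl j).
by right; exists (bl j), (pivot_dir j); split => //; exact: pivot_dir_orth.
Qed.

Lemma sum_unit_block al (F : R) : \sum_(i < N | bl i == al) n i * (n i * F) = F.
Proof.
rewrite (eq_bigr (fun i => n i ^+ 2 * F)) => [|i _]; last by rewrite mulrA expr2.
by rewrite -mulr_suml n_unit mul1r.
Qed.

Lemma basis_unit : exists x0, (\matrix_(j, i) tangent_basis j i x0) \in unitmx.
Proof.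
have [x0 [psi0 Qinj]] := good_point h_gt0 (fun x i => vvec_neq0 mu_lt0 x (a_neq0 i)) (vvec_cvg0 mu_lt0 a).
exists x0; rewrite -row_free_unit -kermx_eq0; apply/rowV0P => u /sub_kermxP uM.
have uB i : \sum_j u 0 j * tangent_basis j i x0 = 0.
  have /rowP/(_ i) := uM; rewrite !mxE => e; rewrite -[RHS]e.
  by apply: eq_bigr => j _; rewrite mxE.
have V0 al : V mu_ a al x0 != 0 by rewrite V_psi// mulf_neq0// gt_eqF// amp_gt0.
(* The coefficients of the parameter derivatives, weighted so that their contribution projected on
   [n] is [amp_al (Q z)_al]. *)
pose z : 'cV[R]_K := \col_be (u 0 (pivot be) * (a be)^-1 * psi h (v x0) be 0).
have z0 : z = 0.
  apply: Qinj; apply/colP => al; rewrite [RHS]mxE.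
  (* Pairing with [n] on one block removes all rotations and leaves the parameter derivatives. *)
  have : \sum_(i | bl i == al) n i * (\sum_j u 0 j * tangent_basis j i x0) = 0.
    by rewrite big1// => i _; rewrite uB mulr0.
  under eq_bigr do rewrite mulr_sumr.
  rewrite exchange_big/=.
  rewrite (eq_bigr (fun j => if j == pivot (bl j) then
      u 0 j * (amp mu_ al * tang h v (param_rate a (bl j)) x0 al 0) else 0)); last first.
    move=> j _; rewrite /tangent_basis; case: ifP => _; last first.
      rewrite -[RHS](mulr0 (u 0 j)).
      have [ja|ja] := eqVneq (bl j) al.
        transitivity (u 0 j * V mu_ a al x0 * \sum_(i < N | bl i == al) pivot_dir j i * n i).
          by rewrite mulr_sumr; apply: eq_bigr => i ial; rewrite /Psi ja ial; ring.
        by rewrite -ja pivot_dir_orth !mulr0.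
      rewrite mulr0 big1// => i /eqP ial; rewrite /Psi ial eq_sym (negbTE ja); ring.
    rewrite -[X in _ = _ * X](sum_unit_block al) mulr_sumr.
    by apply: eq_bigr => i /eqP ial; rewrite Phi_E// ial; ring.
  rewrite (partition_big bl predT)//= => e.
  apply: (mulfI (lt0r_neq0 (amp_gt0 mu_lt0 al))); rewrite mulr0 -[RHS]e mxE mulr_sumr.
  apply: eq_bigr => be _.
  rewrite (bigD1 (pivot be)) ?block_pivot//= eqxx [X in _ + X]big1 ?addr0; last first.
    move=> j /andP[/eqP jb jp]; rewrite jb (negbTE jp)//.
  have -> : z be 0 = u 0 (pivot be) * (a be)^-1 * psi h (v x0) be 0 by rewrite mxE.
  rewrite /tang.
  have -> : (Qmx h (v x0) *m dmx (param_rate a be) *m psi h (v x0)) al 0 =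
     Qmx h (v x0) al be * ((a be)^-1 * psi h (v x0) be 0).
    rewrite -mulmxA mxE (bigD1 be)//= mul_dmxE /param_rate eqxx big1 ?addr0// => c cb.
    by rewrite mul_dmxE (negbTE cb) mul0r mulr0.
  by ring.
have up be : u 0 (pivot be) = 0.
  have /colP/(_ be) := z0; rewrite mxE [RHS]mxE => /eqP; rewrite !mulf_eq0 invr_eq0.
  by rewrite (negbTE (a_neq0 be)) (negbTE (psi0 be)) !orbF => /eqP.
apply/rowP => i; rewrite [RHS]mxE; have [ip|ip] := eqVneq i (pivot (bl i)).
  by rewrite ip up.
(* With the pivot coefficients gone, component [i] sees only the rotation of index [i], whose value
   there is [V], nonzero at [x0]. *)
have := uB i; rewrite (bigD1 i)//= [X in _ + X]big1 ?addr0; last first.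
  move=> j ji; rewrite /tangent_basis; case: ifP => [/eqP ->|_]; first by rewrite up mul0r.
  rewrite /Psi; case: eqP => [ij|_]; last by rewrite mulr0.
  by rewrite /pivot_dir eq_sym (negbTE ji) -ij (negbTE ip) mulr0 subrr mul0r mulr0.
rewrite /tangent_basis (negbTE ip) /Psi eqxx /pivot_dir eqxx (negbTE ip) mulr0 subr0 mul1r => /eqP.
by rewrite mulf_eq0 (negbTE (V0 _)) orbF => /eqP.
Qed.

Lemma ker_solset : ker_linearized mu_ (U mu_ a n) = solset.
Proof.
have [B cB] := coef_bound mu_lt0 a n.
have cc i l : continuous (fun x => coef x i l) by exact: coef_cont.
have lE (phi : 'I_N -> R -> R) i psi : linearized mu_ (U mu_ a n) phi i psi =
   \int[lebesgue_measure]_x (- (phi i x * derive1n 2 psi x) + rhs coef phi i x * psi x).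
  by apply: eq_Rintegral => x _; rewrite rhs_coef; congr (_ + _ * _); ring.
apply/seteqP; split=> u.
  move=> [phi [-> H1 lin]].
  have [|P [Q [PQ ae]]] := weak_sol_classical cc cB (p := phi).
    by split=> // i psi tpsi; rewrite -lE; exact: lin.
  exists P, Q; split => //; apply/funext => i; apply/aeclassP.
  have FF := ae_filter_ringOfSetsType (@lebesgue_measure R).
  by apply: filterS (ae i) => x e _.
move=> [p [q [pq ->]]]; exists p.
have [H1 w] := L2_sol_weak cc pq.
by split=> // i psi tpsi; rewrite lE; exact: w.
Qed.

Lemma solset_span : solset = lspan (range (fun j => tclass (tangent_basis j))).
Proof.
have [B cB] := coef_bound mu_lt0 a n.
have [x0 ux0] := basis_unit.
apply/seteqP; split.
  move=> u [p [q [pq ->]]].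
  pose Q j := sval (cid (basis_sol j)).
  have PQ j : L2_sol coef (tangent_basis j) (Q j) by exact: (svalP (cid (basis_sol j))).
  have [c pc] := L2_sol_span (@coef_sym R K k mu_ a n) cB PQ ux0 pq.
  exists N, c, (fun j => tclass (tangent_basis j)); split=> [j|]; first by exists j.
  rewrite -tclass_lin; congr tclass; apply/funext => i; apply/funext => x; exact: pc.
apply: lspan_L2_sol => u [j _ <-]; have [Q sQ] := basis_sol j.
by exists (tangent_basis j), Q.
Qed.

(** All generators of the tangent space are solutions, solutions are spanned by the basis fields,
    and these are generators. *)
Lemma solset_tangent : solset = tangent mu_ a n.
Proof.
apply/seteqP; split.
  rewrite solset_span; apply: lspan_sub => u [j _ <-]; exact: basis_tangent.
apply: lspan_L2_sol => u [[ga ->]|[al [c [cn ->]]]].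
  by have [Q sQ] := L2_sol_Phi mu_lt0 a_neq0 n_unit ga; exists (Phi mu_ a n ga), Q.
by have [Q sQ] := L2_sol_Psi cn; exists (Psi mu_ a al c), Q.
Qed.

(** A combination that is null almost everywhere is continuous, hence zero at [x0] too, where the
    values are independent. *)
Lemma basis_free (c : 'I_N -> R) : \sum_j c j *: tclass (tangent_basis j) = 0 -> forall j, c j = 0.
Proof.
rewrite -tclass_lin => c0.
have [x0 ux0] := basis_unit.
have cb i : continuous (fun x => \sum_j c j * tangent_basis j i x).
  move=> x; apply: cvg_sumf => j; apply: cvgMr.
  have [Q [[dP _] _]] := basis_sol j; exact: is_derive_continuous (dP i x).
have s0 i x : \sum_j c j * tangent_basis j i x = 0.
  have : (fun x => \sum_j c j * tangent_basis j i x) = fun=> 0.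
    apply: ae_eq_continuous => //; first exact: cst_continuous.
    have := congr1 (fun f => f i) c0; rewrite /tclass /= -[RHS]/(0 : aefun R) -aeclass0 => /aeclassP.
    have FF := ae_filter_ringOfSetsType (@lebesgue_measure R).
    by apply: filterS => y; exact.
  by move/(congr1 (fun f => f x)).
have : (\row_j c j) *m (\matrix_(j, i) tangent_basis j i x0) = 0.
  apply/rowP => i; rewrite !mxE -[RHS](s0 i x0); apply: eq_bigr => j _; by rewrite !mxE.
move/(congr1 (mulmx^~ (invmx (\matrix_(j, i) tangent_basis j i x0)))); rewrite mulmxK// mul0mx.
by move=> /rowP c1 j; have := c1 j; rewrite !mxE.
Qed.

End Main.

Unset Implicit Arguments.
Set Strict Implicit.
Set Printing Implicit Defensive.

Theorem theorem1p4 (R : realType) (K : nat) (k : 'I_K -> nat) (mu : 'I_K -> R)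
    (hN : (2 <= \sum_(al < K) k al)%N)
    (hk : forall al, (1 <= k al)%N)
    (hmu : forall al be : 'I_K, (al < be)%N -> mu al < mu be)
    (hmu0 : forall al, mu al < 0)
    (a : 'I_K -> R) (ha : forall al, a al != 0)
    (n : 'I_(\sum_(al < K) k al) -> R) (hn : unit_blocks n) :
  has_dim (ker_linearized mu (U mu a n)) (\sum_(al < K) k al)%N
  /\ ker_linearized mu (U mu a n) = tangent mu a n.
Proof.
rewrite (ker_solset hmu0); split; last exact: solset_tangent.
exists (fun j => tclass (tangent_basis mu a hn j)); split.
  exact: basis_free.
exact: solset_span.
Qed.
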